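(* Let $m\in\mathbb N$, $c>0$ and $\theta>0$, with $m^3\theta$ sufficiently small. Suppose that a rank-$m$ orthogonal projection $P$ on $\ell^2(\mathbb Z^d)$ satisfies $$\max_{x,y\in\mathbb Z^d}|P(x,y)|\,e^{c|x-y|}\le\theta^{-1}.$$ Then $P=\sum_{i=1}^mP_i$, where the $P_i=|\psi_i\rangle\langle\psi_i|$ are mutually orthogonal rank-one projections, with normalized $\psi_i$, satisfying the following for each $i$: - $M(\psi_i)\ge|\ln\theta|^{-d-1}$; - for some $x_i\in\mathbb Z^d$ and all $y\in\mathbb Z^d$, $$|\psi_i(y)|\le\theta^{-2}e^{-c'|y-x_i|/m},$$ where $c'>0$ is a constant independent of $m$.
   Context: Distances on $\mathbb Z^d$ are $\ell^\infty$. $P(x,y)=\langle\delta_x,P\delta_y\rangle$. For $\psi\in\ell^2(\mathbb Z^d)$, $M(\psi)=\max_{x\in\mathbb Z^d}|\psi(x)|^2$. *)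

(* Defs.v *)
From Stdlib Require Import Reals ZArith List.
From Coquelicot Require Import Coquelicot.
Open Scope R_scope.

Definition Zd (d : nat) : Type := {v : list Z | length v = d}.

Definition linf_dist {d : nat} (x y : Zd d) : R :=
  fold_right Rmax 0
    (map (fun p : Z * Z => IZR (Z.abs (fst p - snd p)))
         (combine (proj1_sig x) (proj1_sig y))).

Definition Csum (l : list C) : C := fold_right Cplus (RtoC 0) l.

Definition HasSum {T : Type} (f : T -> C) (s : C) : Prop :=
  forall eps : R, 0 < eps ->
    exists F0 : list T, forall F : list T, NoDup F -> incl F0 F ->
      Cmod (Cminus (Csum (map f F)) s) < eps.

(* An element of l^2(Z^d) viewed as a function Z^d -> C. *)
Definition vec (d : nat) : Type := Zd d -> C.

Definition orthonormal {d : nat} (m : nat) (phi : nat -> vec d) : Prop :=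
  forall i j, (i < m)%nat -> (j < m)%nat ->
    HasSum (fun x => Cmult (Cconj (phi i x)) (phi j x))
           (if Nat.eqb i j then RtoC 1 else RtoC 0).

(* Kernel of sum_{k<m} |phi_k><phi_k| : (x,y) |-> sum_k phi_k(x) conj(phi_k(y)). *)
Definition proj_kernel {d : nat} (m : nat) (phi : nat -> vec d) (x y : Zd d) : C :=
  Csum (map (fun k => Cmult (phi k x) (Cconj (phi k y))) (seq 0 m)).

(* P (given by its matrix elements P(x,y) = <delta_x, P delta_y>) is a
   rank-m orthogonal projection on l^2(Z^d): it is the projection onto the
   span of an orthonormal family of m vectors. *)
Definition is_rank_proj {d : nat} (m : nat) (P : Zd d -> Zd d -> C) : Prop :=
  exists phi : nat -> vec d, orthonormal m phi /\
    forall x y, P x y = proj_kernel m phi x y.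

(* M(psi) >= r, where M(psi) = max_x |psi(x)|^2 (the max is attained for
   psi in l^2), i.e. some site carries weight at least r. *)
Definition M_ge {d : nat} (psi : vec d) (r : R) : Prop :=
  exists x : Zd d, r <= (Cmod (psi x)) ^ 2.

(* Main.v *)
(* Write [L = - ln theta] and [p x = P x x]. A site is heavy when [p] is at least a fixed multiple of [L^-d]; the ball of radius of order [L] around a heavy site carries mass at least 1/2, so a separated net of heavy sites has at most [2m] points, and grouping them at scale [L] gives clusters of diameter [O(m L)]. Label the sites near the clusters by the cluster ([a x], with [a x = 0] far away); then [P x y] is smaller than [theta^11] whenever [a x <> a y]. In an orthonormal eigenbasis of the compression of [a] to the range of [P], a maximum principle for [(lam - a y) f y = sum_x (a x - a y) P(y,x) f x] shows that each eigenfunction is negligible outside a single cluster and decays exponentially away from it.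

The eigenfunctions of one cluster can be flat, but they may be rotated among themselves without spoiling the decay. Their kernel [Q] is close to [P] on the cluster, so a quarter of its trace sits on sites with [Q x x] of order at least [L^-d]. Greedy pivoting on these sites turns at least an eighth of the family into vectors peaked at a pivot site, while the others vanish at all pivot sites; rotating leftovers with pivots distributes the weight. Finally, a bound [exp(C m L - c D / 8)] together with the trivial bound 1 gives [theta^-2 exp(- c' D / m)] by interpolation. *)
Require Import Defs.
From Stdlib Require Import Reals ZArith List Lra Lia Psatz.
From Stdlib Require Import Permutation Classical ClassicalEpsilon FunctionalExtensionality ProofIrrelevance.
From mathcomp Require all_boot all_order all_algebra Rstruct complex.
From Coquelicot Require Import Coquelicot.
Open Scope R_scope.

(** * Finite and unconditional sums *)

(** Cutting [P] off to the clusters would give only approximately orthogonal vectors. Diagonalizing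
    the compression of [a] merely changes the basis of the range of [P] by a unitary matrix, so
    orthonormality and the sum [P] stay exact. Integer labels provide the gap: an eigenvalue lies
    within 1/4 of the label at the near maximum of its eigenfunction, hence at least 3/4 away from
    every other label. Degenerate eigenvalues do no harm, since each eigenfunction is localized on
    its own. The eigenvalues say nothing about peaks inside a cluster, and this forces the second
    stage of rotations.

    Losses are counted in powers of [exp L], that is 1/theta: the rank, the lattice constant [S0]
    and each ball volume cost at most one power, and the exponent 11 for couplings between different
    labels pays for all of them. The rate loses a factor [m] because all net points may form one
    chain. The spare power in [L^(d+1)] against [L^d] absorbs the numerical constants in the lower
    bound for the peaks. *)

Definition lsum {T : Type} (f : T -> R) (l : list T) : R :=
  fold_right Rplus 0 (map f l).

Definition eq_dec_classic (T : Type) (x y : T) : {x = y} + {x <> y} :=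
  excluded_middle_informative (x = y).

Definition selectP {T : Type} (Q : T -> Prop) (l : list T) : list T :=
  filter (fun x => if excluded_middle_informative (Q x) then true else false) l.

Lemma in_selectP {T : Type} (Q : T -> Prop) (l : list T) (x : T) :
  In x (selectP Q l) <-> In x l /\ Q x.
Proof.
  unfold selectP; rewrite filter_In.
  destruct (excluded_middle_informative (Q x)); intuition discriminate.
Qed.

Lemma NoDup_selectP {T : Type} (Q : T -> Prop) (l : list T) :
  NoDup l -> NoDup (selectP Q l).
Proof. intros; now apply NoDup_filter. Qed.

Lemma selectP_split {T : Type} (Q : T -> Prop) (l : list T) :
  Permutation l (selectP Q l ++ selectP (fun x => ~ Q x) l).
Proof.
  induction l as [|x l IH]; simpl; [constructor|].
  destruct (excluded_middle_informative (Q x));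
    destruct (excluded_middle_informative (~ Q x)); try tauto; simpl.
  - now constructor.
  - apply Permutation_cons_app, IH.
Qed.

Lemma lsum_cons {T} (f : T -> R) x l : lsum f (x :: l) = f x + lsum f l.
Proof. reflexivity. Qed.

Lemma lsum_app {T} (f : T -> R) l1 l2 : lsum f (l1 ++ l2) = lsum f l1 + lsum f l2.
Proof.
  induction l1 as [|x l IH]; simpl; rewrite ?lsum_cons.
  - unfold lsum at 2; simpl; ring.
  - rewrite IH; ring.
Qed.

Lemma lsum_perm {T} (f : T -> R) l1 l2 : Permutation l1 l2 -> lsum f l1 = lsum f l2.
Proof.
  induction 1; rewrite ?lsum_cons; try reflexivity; lra.
Qed.

Lemma lsum_plus {T} (f g : T -> R) l :
  lsum (fun x => f x + g x) l = lsum f l + lsum g l.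
Proof.
  induction l as [|x l IH]; rewrite ?lsum_cons; [unfold lsum; simpl; ring|].
  rewrite IH; ring.
Qed.

Lemma lsum_scal {T} (c : R) (f : T -> R) l :
  lsum (fun x => c * f x) l = c * lsum f l.
Proof.
  induction l as [|x l IH]; rewrite ?lsum_cons; [unfold lsum; simpl; ring|].
  rewrite IH; ring.
Qed.

Lemma lsum_le {T} (f g : T -> R) l :
  (forall x, In x l -> f x <= g x) -> lsum f l <= lsum g l.
Proof.
  induction l as [|x l IH]; intros H; rewrite ?lsum_cons; [unfold lsum; simpl; lra|].
  specialize (IH (fun y Hy => H y (or_intror Hy))).
  specialize (H x (or_introl eq_refl)); lra.
Qed.

Lemma lsum_ext {T} (f g : T -> R) l :
  (forall x, In x l -> f x = g x) -> lsum f l = lsum g l.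
Proof.
  intros H; apply Rle_antisym; apply lsum_le; intros x Hx; rewrite (H x Hx); lra.
Qed.

Lemma lsum_const {T} (c : R) (l : list T) :
  lsum (fun _ => c) l = INR (length l) * c.
Proof.
  induction l as [|x l IH]; rewrite ?lsum_cons; [unfold lsum; simpl; ring|].
  rewrite IH. change (length (x :: l)) with (S (length l)); rewrite S_INR; ring.
Qed.

Lemma lsum_nonneg {T} (f : T -> R) l :
  (forall x, In x l -> 0 <= f x) -> 0 <= lsum f l.
Proof.
  intros H. replace 0 with (lsum (fun _ : T => 0) l).
  - now apply lsum_le.
  - rewrite lsum_const; ring.
Qed.

Lemma lsum_incl {T} (f : T -> R) l1 l2 :
  NoDup l1 -> incl l1 l2 -> (forall x, In x l2 -> 0 <= f x) -> lsum f l1 <= lsum f l2.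
Proof.
  revert l2; induction l1 as [|x l IH]; intros l2 Hn Hi Hf.
  - now apply lsum_nonneg.
  - inversion Hn; subst.
    destruct (in_split x l2 (Hi x (or_introl eq_refl))) as [a [b ->]].
    rewrite <- (lsum_perm f _ _ (Permutation_middle a b x)), !lsum_cons.
    apply Rplus_le_compat_l, IH; auto.
    + intros y Hy. specialize (Hi y (or_intror Hy)).
      rewrite in_app_iff in *; simpl in Hi. destruct Hi as [?|[->|?]]; tauto.
    + intros y Hy; apply Hf; rewrite in_app_iff in *; simpl; tauto.
Qed.

Lemma lsum_ge_one {T} (f : T -> R) l x :
  In x l -> (forall y, In y l -> 0 <= f y) -> f x <= lsum f l.
Proof.
  intros Hx Hf.
  assert (H := lsum_incl f (x :: nil) l (NoDup_cons x (@in_nil T x) (NoDup_nil T))).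
  rewrite lsum_cons in H; unfold lsum at 1 in H; simpl in H.
  assert (f x + 0 <= lsum f l); [apply H; auto|lra].
  intros y [<-|[]]; auto.
Qed.

Lemma lsum_swap {T U} (f : T -> U -> R) l1 l2 :
  lsum (fun x => lsum (f x) l2) l1 = lsum (fun y => lsum (fun x => f x y) l1) l2.
Proof.
  induction l1 as [|x l IH].
  - unfold lsum at 1; simpl. symmetry.
    transitivity (lsum (fun _ : U => 0) l2); [now apply lsum_ext|].
    rewrite lsum_const; ring.
  - rewrite lsum_cons, IH, <- lsum_plus. now apply lsum_ext.
Qed.

Lemma lsum_flat_map {T U} (f : U -> R) (g : T -> list U) l :
  lsum f (flat_map g l) = lsum (fun x => lsum f (g x)) l.
Proof.
  induction l as [|x l IH]; [reflexivity|].
  simpl flat_map; rewrite lsum_app, lsum_cons, IH; reflexivity.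
Qed.

Lemma lsum_map {T U} (f : U -> R) (g : T -> U) l :
  lsum f (map g l) = lsum (fun x => f (g x)) l.
Proof. unfold lsum; now rewrite map_map. Qed.

Lemma lsum_cauchy_schwarz {T} (f g : T -> R) l :
  (lsum (fun x => f x * g x) l) ^ 2 <=
  lsum (fun x => f x ^ 2) l * lsum (fun x => g x ^ 2) l.
Proof.
  set (A := lsum (fun x => f x ^ 2) l); set (B := lsum (fun x => g x ^ 2) l).
  set (C := lsum (fun x => f x * g x) l).
  assert (HA : 0 <= A) by (apply lsum_nonneg; intros; apply pow2_ge_0).
  assert (HB : 0 <= B) by (apply lsum_nonneg; intros; apply pow2_ge_0).
  assert (H : forall s t, 0 <= s ^ 2 * A + 2 * s * t * C + t ^ 2 * B).
  { intros s t. unfold A, B, C. rewrite <- !lsum_scal, <- !lsum_plus.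
    apply lsum_nonneg; intros x _.
    replace (_ + _) with ((s * f x + t * g x) ^ 2) by ring. apply pow2_ge_0. }
  destruct (Req_dec A 0) as [E|E].
  - assert (C = 0); [|nra].
    destruct (Req_dec C 0) as [|HC]; auto.
    (* For [A = 0] the form is affine in [s], and this [s] would give it the value [- B - 2]. *)
    specialize (H (- (B + 1) / C) 1). rewrite E in H.
    replace (2 * (- (B + 1) / C) * 1 * C) with (-2 * (B + 1)) in H by (field; auto). lra.
  - specialize (H (- C) A). nra.
Qed.

Definition csum {T : Type} (f : T -> C) (l : list T) : C := Csum (map f l).

Lemma csum_cons {T} (f : T -> C) x l : csum f (x :: l) = Cplus (f x) (csum f l).
Proof. reflexivity. Qed.

Lemma csum_app {T} (f : T -> C) l1 l2 :
  csum f (l1 ++ l2) = Cplus (csum f l1) (csum f l2).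
Proof.
  induction l1 as [|x l IH]; simpl; rewrite ?csum_cons.
  - unfold csum at 2; simpl; ring.
  - rewrite IH; ring.
Qed.

Lemma csum_perm {T} (f : T -> C) l1 l2 : Permutation l1 l2 -> csum f l1 = csum f l2.
Proof.
  induction 1; rewrite ?csum_cons; try reflexivity; try congruence. ring.
Qed.

Lemma csum_plus {T} (f g : T -> C) l :
  csum (fun x => Cplus (f x) (g x)) l = Cplus (csum f l) (csum g l).
Proof.
  induction l as [|x l IH]; rewrite ?csum_cons; [unfold csum; simpl; ring|].
  rewrite IH; ring.
Qed.

Lemma csum_scal {T} (c : C) (f : T -> C) l :
  csum (fun x => Cmult c (f x)) l = Cmult c (csum f l).
Proof.
  induction l as [|x l IH]; rewrite ?csum_cons; [unfold csum; simpl; ring|].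
  rewrite IH; ring.
Qed.

Lemma csum_ext {T} (f g : T -> C) l :
  (forall x, In x l -> f x = g x) -> csum f l = csum g l.
Proof.
  induction l as [|x l IH]; intros H; rewrite ?csum_cons; [reflexivity|].
  rewrite IH, H; auto; [now left | intros; apply H; now right].
Qed.

Lemma csum_zero {T} (f : T -> C) l :
  (forall x, In x l -> f x = RtoC 0) -> csum f l = RtoC 0.
Proof.
  induction l as [|x l IH]; intros H; rewrite ?csum_cons; [reflexivity|].
  rewrite IH, H; [ring | now left | intros; apply H; now right].
Qed.

Lemma csum_swap {T U} (f : T -> U -> C) l1 l2 :
  csum (fun x => csum (f x) l2) l1 = csum (fun y => csum (fun x => f x y) l1) l2.
Proof.
  induction l1 as [|x l IH].
  - unfold csum at 1; simpl. symmetry. now apply csum_zero.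
  - rewrite csum_cons, IH, <- csum_plus. now apply csum_ext.
Qed.

Lemma Cmod_csum_le {T} (f : T -> C) l : Cmod (csum f l) <= lsum (fun x => Cmod (f x)) l.
Proof.
  induction l as [|x l IH].
  - unfold csum, lsum; simpl. rewrite Cmod_0; lra.
  - rewrite csum_cons, lsum_cons. eapply Rle_trans; [apply Cmod_triangle|lra].
Qed.

Lemma csum_RtoC {T} (f : T -> R) l : csum (fun x => RtoC (f x)) l = RtoC (lsum f l).
Proof.
  induction l as [|x l IH]; [reflexivity|].
  rewrite csum_cons, lsum_cons, IH, RtoC_plus; reflexivity.
Qed.

Lemma csum_conj {T} (f : T -> C) l : csum (fun x => Cconj (f x)) l = Cconj (csum f l).
Proof.
  induction l as [|x l IH].
  - unfold csum; simpl. unfold Cconj, RtoC; simpl. f_equal; ring.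
  - rewrite !csum_cons, IH, Cplus_conj; reflexivity.
Qed.

Lemma Cmult_conj_r (z : C) : Cmult z (Cconj z) = RtoC (Cmod z ^ 2).
Proof. now rewrite <- Cmod2_conj. Qed.

Lemma Cconj_RtoC (r : R) : Cconj (RtoC r) = RtoC r.
Proof. unfold Cconj, RtoC; simpl; f_equal; ring. Qed.

Lemma HasSum_plus {T} (f g : T -> C) s t :
  HasSum f s -> HasSum g t -> HasSum (fun x => Cplus (f x) (g x)) (Cplus s t).
Proof.
  intros Hf Hg eps He.
  destruct (Hf (eps / 2)) as [F Hf']; [lra|].
  destruct (Hg (eps / 2)) as [G Hg']; [lra|].
  exists (F ++ G); intros L HL Hi.
  apply incl_app_inv in Hi; destruct Hi as [Hi1 Hi2].
  specialize (Hf' L HL Hi1); specialize (Hg' L HL Hi2).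
  fold (csum f L) in Hf'; fold (csum g L) in Hg'.
  fold (csum (fun x => Cplus (f x) (g x)) L).
  rewrite csum_plus.
  replace (Cminus _ _) with (Cplus (Cminus (csum f L) s) (Cminus (csum g L) t)) by ring.
  eapply Rle_lt_trans; [apply Cmod_triangle|lra].
Qed.

Lemma HasSum_scal {T} (c : C) (f : T -> C) s :
  HasSum f s -> HasSum (fun x => Cmult c (f x)) (Cmult c s).
Proof.
  intros Hf eps He.
  assert (Hc := Cmod_ge_0 c).
  destruct (Hf (eps / (Cmod c + 1))) as [F Hf']; [apply Rdiv_lt_0_compat; lra|].
  exists F; intros L HL Hi.
  specialize (Hf' L HL Hi).
  fold (csum f L) in Hf'; fold (csum (fun x => Cmult c (f x)) L).
  rewrite csum_scal.
  replace (Cminus _ _) with (Cmult c (Cminus (csum f L) s)) by ring.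
  rewrite Cmod_mult.
  apply Rle_lt_trans with (Cmod c * (eps / (Cmod c + 1))).
  - apply Rmult_le_compat_l; lra.
  - replace (Cmod c * (eps / (Cmod c + 1))) with (eps * (Cmod c / (Cmod c + 1))) by (field; lra).
    assert (Cmod c / (Cmod c + 1) < 1); [|nra].
    apply Rlt_div_l; lra.
Qed.

Lemma HasSum_ext {T} (f g : T -> C) s :
  (forall x, f x = g x) -> HasSum f s -> HasSum g s.
Proof.
  intros H Hf. now replace g with f by (extensionality x; apply H).
Qed.

Lemma HasSum_eq {T} (f : T -> C) s t : HasSum f s -> s = t -> HasSum f t.
Proof. now intros H <-. Qed.

Lemma HasSum_conj {T} (f : T -> C) s :
  HasSum f s -> HasSum (fun x => Cconj (f x)) (Cconj s).
Proof.
  intros Hf eps He. destruct (Hf eps He) as [F HF]; exists F; intros L HL Hi.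
  specialize (HF L HL Hi).
  fold (csum f L) in HF; fold (csum (fun x => Cconj (f x)) L).
  rewrite csum_conj, <- Cminus_conj, Cmod_conj; exact HF.
Qed.

Lemma HasSum_zero {T} : HasSum (fun _ : T => RtoC 0) (RtoC 0).
Proof.
  intros eps He; exists nil; intros L _ _.
  fold (csum (fun _ : T => RtoC 0) L). rewrite csum_zero by reflexivity.
  replace (Cminus _ _) with (RtoC 0) by ring. now rewrite Cmod_0.
Qed.

Lemma HasSum_csum {T U} (f : U -> T -> C) (s : U -> C) l :
  (forall u, In u l -> HasSum (f u) (s u)) ->
  HasSum (fun x => csum (fun u => f u x) l) (csum s l).
Proof.
  induction l as [|u l IH]; intros H.
  - exact HasSum_zero.
  - apply (HasSum_ext (fun x => Cplus (f u x) (csum (fun u => f u x) l)));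
      [reflexivity|].
    rewrite csum_cons. apply HasSum_plus; [apply H; now left|].
    apply IH; intros; apply H; now right.
Qed.

(** [HasSum] tests duplicate-free lists only, while its witness [F0] may contain repetitions; this
    yields a list on which it can be tested. *)
Lemma NoDup_superlist {T : Type} (l1 l2 : list T) :
  exists F, NoDup F /\ incl l1 F /\ incl l2 F.
Proof.
  exists (nodup (eq_dec_classic T) (l1 ++ l2)). split; [apply NoDup_nodup|].
  split; intros x Hx; apply nodup_In, in_app_iff; tauto.
Qed.

Lemma NoDup_incl_perm {T : Type} (l F : list T) :
  NoDup l -> NoDup F -> incl l F ->
  exists G, Permutation F (l ++ G) /\ NoDup G /\ (forall x, In x G -> ~ In x l).
Proof.
  intros Hl HF Hi. exists (selectP (fun x => ~ In x l) F).
  split; [|split].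
  - etransitivity; [apply (selectP_split (fun x => In x l))|].
    apply Permutation_app_tail. apply NoDup_Permutation; auto using NoDup_selectP.
    intros x; rewrite in_selectP; firstorder.
  - now apply NoDup_selectP.
  - intros x Hx; now apply in_selectP in Hx.
Qed.

Lemma HasSum_finite {T} (f : T -> C) (l : list T) :
  NoDup l -> (forall x, ~ In x l -> f x = RtoC 0) -> HasSum f (csum f l).
Proof.
  intros Hl Hf eps He; exists l; intros F HF Hi.
  destruct (NoDup_incl_perm l F Hl HF Hi) as [G [HG [_ HG']]].
  fold (csum f F). rewrite (csum_perm f _ _ HG), csum_app.
  rewrite (csum_zero f G) by auto.
  replace (Cminus _ _) with (RtoC 0) by ring. now rewrite Cmod_0.
Qed.

(** Infinite sums are always estimated through finite sublists, here and in the two real variants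
    that follow, so no separate theory of absolute convergence is required. *)
Lemma HasSum_norm_le {T} (f : T -> C) s B :
  HasSum f s -> (forall F, NoDup F -> lsum (fun x => Cmod (f x)) F <= B) -> Cmod s <= B.
Proof.
  intros Hf HB. apply Rnot_lt_le; intros Hlt.
  destruct (Hf (Cmod s - B)) as [F0 HF0]; [lra|].
  destruct (NoDup_superlist F0 nil) as [F [HF [Hi _]]].
  specialize (HF0 F HF Hi); fold (csum f F) in HF0.
  specialize (HB F HF). assert (H := Cmod_csum_le f F).
  assert (Cmod s <= Cmod (Cminus (csum f F) s) + Cmod (csum f F)); [|lra].
  replace s with (Cplus (Copp (Cminus (csum f F) s)) (csum f F)) at 1 by ring.
  eapply Rle_trans; [apply Cmod_triangle|]. rewrite Cmod_opp; lra.
Qed.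

Lemma HasSum_real_ge {T} (g : T -> R) (s : R) F :
  HasSum (fun x => RtoC (g x)) (RtoC s) -> (forall x, 0 <= g x) -> NoDup F ->
  lsum g F <= s.
Proof.
  intros H Hg HF. apply Rnot_lt_le; intros Hlt.
  destruct (H (lsum g F - s)) as [F0 HF0]; [lra|].
  destruct (NoDup_superlist F0 F) as [G [HG [Hi Hi']]].
  specialize (HF0 G HG Hi). fold (csum (fun x => RtoC (g x)) G) in HF0.
  rewrite csum_RtoC, <- RtoC_minus, Cmod_R in HF0.
  assert (lsum g F <= lsum g G) by (apply lsum_incl; auto).
  rewrite Rabs_pos_eq in HF0; lra.
Qed.

Lemma HasSum_real_le {T} (g : T -> R) (s : R) B :
  HasSum (fun x => RtoC (g x)) (RtoC s) ->
  (forall F, NoDup F -> lsum g F <= B) -> s <= B.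
Proof.
  intros H HB. apply Rnot_lt_le; intros Hlt.
  destruct (H (s - B)) as [F0 HF0]; [lra|].
  destruct (NoDup_superlist F0 nil) as [G [HG [Hi _]]].
  specialize (HF0 G HG Hi). fold (csum (fun x => RtoC (g x)) G) in HF0.
  rewrite csum_RtoC, <- RtoC_minus, Cmod_R in HF0.
  specialize (HB G HG). rewrite Rabs_left1 in HF0; lra.
Qed.

(** If every list with [Q] could be extended, there would be such lists of every length. It replaces
    greedy choices, both for enumerating balls and for nets. *)
Lemma bounded_maximal_list {T : Type} (Q : list T -> Prop) (N : nat) :
  Q nil -> (forall l, Q l -> (length l <= N)%nat) ->
  exists l, Q l /\ forall x, ~ Q (x :: l).
Proof.
  intros H0 HN. apply NNPP; intros Hno.
  assert (H : forall n, exists l, Q l /\ length l = n).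
  { induction n as [|n [l [Hl El]]]; [now exists nil|].
    apply NNPP; intros Hn. apply Hno; exists l; split; auto.
    intros x Hx; apply Hn; exists (x :: l); split; simpl; auto. }
  destruct (H (S N)) as [l [Hl El]]. specialize (HN l Hl); lia.
Qed.

(** * Orthonormal families and their kernels *)

(** A relation rather than a function, so that convergence of the series is part of the assertion.
    It is antilinear in the first argument. *)
Definition ip {T : Type} (f g : T -> C) (s : C) : Prop :=
  HasSum (fun x => Cmult (Cconj (f x)) (g x)) s.

(** Families are lists, not indexed sequences: orthonormality is invariant under permutation, so a
    rotation can act on two vectors brought to the front. *)
Fixpoint ON {T : Type} (E : list (T -> C)) : Prop :=
  match E with
  | nil => True
  | f :: E' => ip f f (RtoC 1) /\ (forall g, In g E' -> ip f g (RtoC 0)) /\ ON E'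
  end.

Definition kern {T : Type} (E : list (T -> C)) (x y : T) : C :=
  csum (fun f => Cmult (f x) (Cconj (f y))) E.

Definition diag {T : Type} (E : list (T -> C)) (x : T) : R :=
  lsum (fun f => Cmod (f x) ^ 2) E.

Lemma ip_ext {T} (f f' g g' : T -> C) s :
  (forall x, f x = f' x) -> (forall x, g x = g' x) -> ip f g s -> ip f' g' s.
Proof. intros Hf Hg; apply HasSum_ext; intros x; now rewrite Hf, Hg. Qed.

Lemma ip_sym {T} (f g : T -> C) s : ip f g s -> ip g f (Cconj s).
Proof.
  intros H; apply HasSum_conj in H. eapply HasSum_ext; [|exact H].
  intros x; simpl. rewrite Cmult_conj, Cconj_conj; ring.
Qed.

Lemma ip_sym0 {T} (f g : T -> C) : ip f g (RtoC 0) -> ip g f (RtoC 0).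
Proof. intros H; apply ip_sym in H; now rewrite Cconj_RtoC in H. Qed.

Lemma ip_comb {T} (f1 f2 g1 g2 : T -> C) (a1 a2 b1 b2 s11 s12 s21 s22 : C) :
  ip f1 g1 s11 -> ip f1 g2 s12 -> ip f2 g1 s21 -> ip f2 g2 s22 ->
  ip (fun x => Cplus (Cmult a1 (f1 x)) (Cmult a2 (f2 x)))
     (fun x => Cplus (Cmult b1 (g1 x)) (Cmult b2 (g2 x)))
     (Cplus (Cplus (Cmult (Cmult (Cconj a1) b1) s11) (Cmult (Cmult (Cconj a1) b2) s12))
            (Cplus (Cmult (Cmult (Cconj a2) b1) s21) (Cmult (Cmult (Cconj a2) b2) s22))).
Proof.
  intros H11 H12 H21 H22.
  eapply HasSum_ext;
    [|apply HasSum_plus; apply HasSum_plus; apply HasSum_scal; eassumption].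
  intros x; simpl. rewrite Cplus_conj, !Cmult_conj; ring.
Qed.

Lemma ON_perm {T} (E E' : list (T -> C)) : Permutation E E' -> ON E -> ON E'.
Proof.
  induction 1 as [|f E E' HP IH|f g E|E1 E2 E3 H1 IH1 H2 IH2]; simpl; auto.
  - intros [H1 [H2 H3]]; repeat split; auto.
    intros g Hg; apply H2. eapply Permutation_in; [symmetry|]; eauto.
  - intros [H1 [H2 [H3 [H4 H5]]]]; repeat split; auto.
    intros h [<-|Hh]; [apply ip_sym0, H2; now left | now apply H4].
Qed.

Lemma ON_app_r {T} (E E' : list (T -> C)) : ON (E ++ E') -> ON E'.
Proof. induction E; simpl; tauto. Qed.

Lemma ON_app_l {T} (E E' : list (T -> C)) : ON (E ++ E') -> ON E.
Proof.
  intros H; apply (ON_app_r E' E).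
  eapply ON_perm; [|exact H]. apply Permutation_app_comm.
Qed.

Lemma ON_in {T} (E : list (T -> C)) f : ON E -> In f E -> ip f f (RtoC 1).
Proof. induction E as [|g E IH]; simpl; [tauto|]. intros [H1 [_ H2]] [<-|H]; auto. Qed.

Lemma kern_perm {T} (E E' : list (T -> C)) x y :
  Permutation E E' -> kern E x y = kern E' x y.
Proof. apply csum_perm. Qed.

Lemma kern_app {T} (E E' : list (T -> C)) x y :
  kern (E ++ E') x y = Cplus (kern E x y) (kern E' x y).
Proof. apply csum_app. Qed.

Lemma kern_cons {T} (f : T -> C) E x y :
  kern (f :: E) x y = Cplus (Cmult (f x) (Cconj (f y))) (kern E x y).
Proof. reflexivity. Qed.

Lemma kern_diag {T} (E : list (T -> C)) x : kern E x x = RtoC (diag E x).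
Proof.
  unfold kern, diag. rewrite <- csum_RtoC.
  apply csum_ext; intros f _; apply Cmult_conj_r.
Qed.

Lemma diag_app {T} (E E' : list (T -> C)) x : diag (E ++ E') x = diag E x + diag E' x.
Proof. apply lsum_app. Qed.

Lemma diag_of_kern {T} (E E' : list (T -> C)) :
  (forall x y, kern E x y = kern E' x y) -> forall x, diag E x = diag E' x.
Proof.
  intros H x. apply RtoC_inj. rewrite <- !kern_diag; apply H.
Qed.

Lemma diag_nonneg {T} (E : list (T -> C)) x : 0 <= diag E x.
Proof. apply lsum_nonneg; intros; apply pow2_ge_0. Qed.

Lemma diag_ge {T} (E : list (T -> C)) f x : In f E -> Cmod (f x) ^ 2 <= diag E x.
Proof.
  intros H. apply (lsum_ge_one (fun f => Cmod (f x) ^ 2)); auto.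
  intros; apply pow2_ge_0.
Qed.

Lemma kern_conj {T} (E : list (T -> C)) x y : kern E y x = Cconj (kern E x y).
Proof.
  unfold kern. rewrite <- csum_conj. apply csum_ext; intros f _.
  rewrite Cmult_conj, Cconj_conj; ring.
Qed.

Lemma Cmod_kern_sym {T} (E : list (T -> C)) x y : Cmod (kern E y x) = Cmod (kern E x y).
Proof. rewrite kern_conj; apply Cmod_conj. Qed.

Lemma kern_cauchy_schwarz {T} (E : list (T -> C)) x y :
  Cmod (kern E x y) ^ 2 <= diag E x * diag E y.
Proof.
  eapply Rle_trans; [|apply (lsum_cauchy_schwarz (fun f => Cmod (f x)) (fun f => Cmod (f y)))].
  apply pow_incr; split; [apply Cmod_ge_0|].
  eapply Rle_trans; [apply Cmod_csum_le|].
  apply Req_le, lsum_ext; intros f _. now rewrite Cmod_mult, Cmod_conj.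
Qed.

(** This is [P f = f] for [f] in the family: among the rank-one terms of the kernel only that of [f]
    survives. *)
Lemma ON_reproducing {T} (E : list (T -> C)) f y :
  ON E -> In f E -> HasSum (fun x => Cmult (kern E y x) (f x)) (f y).
Proof.
  assert (H0 : forall E, (forall g, In g E -> ip g f (RtoC 0)) ->
    HasSum (fun x => Cmult (kern E y x) (f x)) (RtoC 0)).
  { intros G HG. apply (HasSum_ext (fun x =>
      csum (fun g => Cmult (g y) (Cmult (Cconj (g x)) (f x))) G)).
    - intros x. unfold kern. rewrite Cmult_comm, <- csum_scal.
      apply csum_ext; intros; ring.
    - rewrite <- (csum_zero (fun g => Cmult (g y) (RtoC 0)) G) by (intros; ring).
      apply (HasSum_csum (fun g x => Cmult (g y) (Cmult (Cconj (g x)) (f x)))).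
      intros g Hg; now apply HasSum_scal, HG. }
  induction E as [|g E IH]; simpl; [tauto|].
  intros [H1 [H2 H3]] Hf.
  apply (HasSum_ext (fun x => Cplus (Cmult (g y) (Cmult (Cconj (g x)) (f x)))
                                    (Cmult (kern E y x) (f x)))).
  { intros x. unfold kern. rewrite csum_cons. ring. }
  destruct Hf as [<-|Hf].
  - apply HasSum_eq with (Cplus (Cmult (g y) (RtoC 1)) (RtoC 0)); [|ring].
    apply HasSum_plus; [now apply HasSum_scal|].
    apply H0; intros h Hh; apply ip_sym0; auto.
  - replace (f y) with (Cplus (Cmult (g y) (RtoC 0)) (f y)) by ring.
    apply HasSum_plus; [now apply HasSum_scal, H2 | now apply IH].
Qed.

(** The identity [P P* = P] read at the diagonal entry [(x, x)]. *)
Lemma ON_kern_row {T} (E : list (T -> C)) x :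
  ON E -> HasSum (fun y => RtoC (Cmod (kern E x y) ^ 2)) (RtoC (diag E x)).
Proof.
  intros HE. rewrite <- kern_diag.
  apply (HasSum_ext (fun y =>
    csum (fun f => Cmult (Cconj (f x)) (Cmult (kern E x y) (f y))) E)).
  - intros y. rewrite <- Cmult_conj_r, <- kern_conj.
    unfold kern at 3. rewrite <- csum_scal. apply csum_ext; intros; ring.
  - unfold kern at 2. rewrite (csum_ext _ (fun f => Cmult (Cconj (f x)) (f x)))
      by (intros; ring).
    apply (HasSum_csum (fun f y => Cmult (Cconj (f x)) (Cmult (kern E x y) (f y)))).
    intros f Hf. now apply HasSum_scal, ON_reproducing.
Qed.

Lemma ON_kern_row_le {T} (E : list (T -> C)) x F :
  ON E -> NoDup F -> lsum (fun y => Cmod (kern E x y) ^ 2) F <= diag E x.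
Proof.
  intros HE HF. apply (HasSum_real_ge _ _ F (ON_kern_row E x HE)); auto.
  intros; apply pow2_ge_0.
Qed.

Lemma ip_self_real {T} (f : T -> C) :
  ip f f (RtoC 1) -> HasSum (fun x => RtoC (Cmod (f x) ^ 2)) (RtoC 1).
Proof.
  apply HasSum_ext; intros x. rewrite Cmult_comm; apply Cmult_conj_r.
Qed.

Lemma unit_sum_le {T} (f : T -> C) F :
  ip f f (RtoC 1) -> NoDup F -> lsum (fun x => Cmod (f x) ^ 2) F <= 1.
Proof.
  intros H HF. apply (HasSum_real_ge _ _ F (ip_self_real f H)); auto.
  intros; apply pow2_ge_0.
Qed.

Lemma unit_pointwise_le {T} (f : T -> C) x : ip f f (RtoC 1) -> Cmod (f x) <= 1.
Proof.
  intros H.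
  assert (H1 := unit_sum_le f (x :: nil) H (NoDup_cons x (@in_nil T x) (NoDup_nil T))).
  unfold lsum in H1; simpl in H1. assert (H2 := Cmod_ge_0 (f x)). nra.
Qed.

Lemma ON_diag_trace {T} (E : list (T -> C)) :
  ON E -> HasSum (fun x => RtoC (diag E x)) (RtoC (INR (length E))).
Proof.
  intros HE.
  apply (HasSum_ext (fun x => csum (fun f => RtoC (Cmod (f x) ^ 2)) E)).
  - intros x; apply csum_RtoC.
  - replace (RtoC (INR (length E))) with (csum (fun _ => RtoC 1) E).
    + apply (HasSum_csum (fun f x => RtoC (Cmod (f x) ^ 2))); intros f Hf.
      now apply ip_self_real, (ON_in E).
    + rewrite csum_RtoC, lsum_const. f_equal; ring.
Qed.

Lemma ON_diag_sum_le {T} (E : list (T -> C)) F :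
  ON E -> NoDup F -> lsum (diag E) F <= INR (length E).
Proof.
  intros HE HF. apply (HasSum_real_ge _ _ F (ON_diag_trace E HE)); auto.
  apply diag_nonneg.
Qed.

Lemma ON_diag_le_1 {T} (E : list (T -> C)) x : ON E -> diag E x <= 1.
Proof.
  intros HE.
  assert (H := ON_kern_row_le E x (x :: nil) HE (NoDup_cons x (@in_nil T x) (NoDup_nil T))).
  unfold lsum in H; simpl in H. rewrite kern_diag, Cmod_R, Rabs_pos_eq in H by apply diag_nonneg.
  assert (H0 := diag_nonneg E x). nra.
Qed.

(** The coefficient rows [(a, b)] and [(- conj b, conj a)] form a unitary matrix, so the pair stays
    orthonormal and orthogonal to the rest. *)
Lemma rotation_ON {T} (f g : T -> C) E (a b : C) :
  Cmod a ^ 2 + Cmod b ^ 2 = 1 -> ON (f :: g :: E) ->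
  ON ((fun x => Cplus (Cmult a (f x)) (Cmult b (g x))) ::
      (fun x => Cplus (Cmult (Copp (Cconj b)) (f x)) (Cmult (Cconj a) (g x))) :: E).
Proof.
  intros Hab [Hf [Hfo [Hg [Hgo HE]]]].
  assert (Hfg : ip f g (RtoC 0)) by (apply Hfo; now left).
  assert (Hgf := ip_sym0 _ _ Hfg).
  assert (Hab' : Cplus (Cmult a (Cconj a)) (Cmult b (Cconj b)) = RtoC 1).
  { rewrite !Cmult_conj_r, <- RtoC_plus, Hab; reflexivity. }
  assert (Hz : forall (p q : C) h, In h E ->
    ip (fun x => Cplus (Cmult p (f x)) (Cmult q (g x))) h (RtoC 0)).
  { intros p q h Hh.
    assert (H := ip_comb f g h h p q (RtoC 1) (RtoC 0) _ _ _ _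
      (Hfo h (or_intror Hh)) (Hfo h (or_intror Hh)) (Hgo h Hh) (Hgo h Hh)).
    match type of H with ip _ _ ?s => replace s with (RtoC 0) in H by ring end.
    eapply ip_ext; [| |exact H]; intros x; simpl; [reflexivity|ring]. }
  simpl; repeat split.
  - match goal with |- ip _ _ ?s => rewrite <- Hab' end.
    assert (H := ip_comb f g f g a b a b _ _ _ _ Hf Hfg Hgf Hg).
    match type of H with ip _ _ ?s =>
      replace s with (Cplus (Cmult a (Cconj a)) (Cmult b (Cconj b))) in H by ring end.
    exact H.
  - intros h [<-|Hh]; [|now apply Hz].
    assert (H := ip_comb f g f g a b (Copp (Cconj b)) (Cconj a) _ _ _ _ Hf Hfg Hgf Hg).
    match type of H with ip _ _ ?s => replace s with (RtoC 0) in H by ring end.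
    exact H.
  - assert (H := ip_comb f g f g (Copp (Cconj b)) (Cconj a) (Copp (Cconj b)) (Cconj a)
      _ _ _ _ Hf Hfg Hgf Hg).
    rewrite Copp_conj, !Cconj_conj in H.
    match type of H with ip _ _ ?s =>
      replace s with (Cplus (Cmult a (Cconj a)) (Cmult b (Cconj b))) in H by ring end.
    rewrite Hab' in H; exact H.
  - intros h Hh; now apply Hz.
  - exact HE.
Qed.

Lemma rotation_kern {T} (f g : T -> C) E (a b : C) x y :
  Cmod a ^ 2 + Cmod b ^ 2 = 1 ->
  kern ((fun x => Cplus (Cmult a (f x)) (Cmult b (g x))) ::
        (fun x => Cplus (Cmult (Copp (Cconj b)) (f x)) (Cmult (Cconj a) (g x))) :: E) x y
  = kern (f :: g :: E) x y.
Proof.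
  intros Hab.
  assert (Hab' : Cplus (Cmult a (Cconj a)) (Cmult b (Cconj b)) = RtoC 1).
  { rewrite !Cmult_conj_r, <- RtoC_plus, Hab; reflexivity. }
  unfold kern; rewrite !csum_cons.
  rewrite !Cplus_conj, !Cmult_conj, Copp_conj, !Cconj_conj.
  transitivity (Cplus (Cmult (Cplus (Cmult a (Cconj a)) (Cmult b (Cconj b)))
     (Cplus (Cmult (f x) (Cconj (f y))) (Cmult (g x) (Cconj (g y)))))
     (csum (fun f0 : T -> C => Cmult (f0 x) (Cconj (f0 y))) E)); [ring|].
  rewrite Hab'; ring.
Qed.

(** * Rotations producing peaked families *)

Lemma annihilating_rotation (u v : C) :
  exists a b : C, Cmod a ^ 2 + Cmod b ^ 2 = 1 /\
    Cplus (Cmult (Copp (Cconj b)) u) (Cmult (Cconj a) v) = RtoC 0.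
Proof.
  assert (Hu := pow2_ge_0 (Cmod u)). assert (Hv := pow2_ge_0 (Cmod v)).
  destruct (Req_dec (Cmod u ^ 2 + Cmod v ^ 2) 0) as [E|E].
  - exists (RtoC 1), (RtoC 0). rewrite Cmod_1, Cmod_0; split; [ring|].
    assert (v = RtoC 0) as -> by (apply Cmod_eq_0; nra).
    rewrite !Cconj_RtoC; ring.
  - set (N := sqrt (Cmod u ^ 2 + Cmod v ^ 2)).
    assert (HN : 0 < N) by (apply sqrt_lt_R0; lra).
    assert (HN2 : N * N = Cmod u ^ 2 + Cmod v ^ 2) by (apply sqrt_sqrt; lra).
    (* The first row is the normalized conjugate of [(u, v)]; the second row then annihilates
       [(u, v)]. *)
    exists (Cmult (RtoC (/ N)) (Cconj u)), (Cmult (RtoC (/ N)) (Cconj v)).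
    split.
    + rewrite !Cmod_mult, !Cmod_conj, Cmod_R, Rabs_pos_eq
        by (left; now apply Rinv_0_lt_compat).
      replace ((/ N * Cmod u) ^ 2 + (/ N * Cmod v) ^ 2)
        with ((Cmod u ^ 2 + Cmod v ^ 2) / (N * N)) by (field; lra).
      rewrite <- HN2; field; lra.
    + rewrite !Cmult_conj, !Cconj_conj, Cconj_RtoC; ring.
Qed.

(* Givens rotations move all the mass of the family at [y] into one vector. *)
Lemma concentrate {T} (y : T) (E : list (T -> C)) : forall f Rst,
  ON (f :: E ++ Rst) ->
  exists f' E', ON (f' :: E' ++ Rst) /\ length E' = length E /\
    (forall x z, kern (f' :: E') x z = kern (f :: E) x z) /\
    (forall g, In g E' -> g y = RtoC 0).
Proof.
  induction E as [|g E IH]; intros f Rst HON.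
  - exists f, nil; split; [exact HON|]; split; [reflexivity|]; split; [reflexivity|].
    simpl; tauto.
  (* [g] waits among the spectators [Rst] while [f] absorbs the other vectors; one more rotation
     then clears [g] at [y]. *)
  - destruct (IH f (g :: Rst)) as [f1 [E1 [H1 [H2 [H3 H4]]]]].
    { eapply ON_perm; [|exact HON]. simpl. constructor. apply Permutation_middle. }
    destruct (annihilating_rotation (f1 y) (g y)) as [a [b [Hab H0]]].
    assert (HON1 : ON (f1 :: g :: E1 ++ Rst)).
    { eapply ON_perm; [|exact H1]. constructor. symmetry; apply Permutation_middle. }
    apply (rotation_ON f1 g (E1 ++ Rst) a b Hab) in HON1.
    eexists; exists ((fun x => Cplus (Cmult (Copp (Cconj b)) (f1 x)) (Cmult (Cconj a) (g x))) :: E1).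
    split; [exact HON1|]. split; [simpl; congruence|]. split.
    + intros x z. rewrite rotation_kern by auto.
      rewrite (kern_perm (f1 :: g :: E1) (g :: f1 :: E1)) by constructor.
      rewrite (kern_perm (f :: g :: E) (g :: f :: E)) by constructor.
      now rewrite !(kern_cons g), H3.
    + intros h [<-|Hh]; auto.
Qed.

Lemma diag_zero {T} (E : list (T -> C)) y :
  diag E y = 0 -> forall f, In f E -> f y = RtoC 0.
Proof.
  intros H f Hf. assert (H1 := diag_ge E f y Hf).
  assert (H2 := Cmod_ge_0 (f y)). apply Cmod_eq_0. nra.
Qed.

Lemma diag_zero_of_all {T} (E : list (T -> C)) y :
  (forall f, In f E -> f y = RtoC 0) -> diag E y = 0.
Proof.
  intros H. unfold diag.
  rewrite (lsum_ext _ (fun _ => 0)).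
  - rewrite lsum_const; ring.
  - intros f Hf. rewrite (H f Hf), Cmod_0; ring.
Qed.

Lemma greedy_pivots {T} (X : list T) (eta : R) :
  0 < eta -> forall n E Rst, length E = n -> ON (E ++ Rst) ->
  exists (P : list ((T -> C) * T)) (Z : list (T -> C)),
    ON (map fst P ++ Z ++ Rst) /\
    (length P + length Z = length E)%nat /\
    (forall x z, kern (map fst P ++ Z) x z = kern E x z) /\
    (forall e y, In (e, y) P -> eta <= Cmod (e y) ^ 2) /\
    (forall e y g, In (e, y) P -> In g Z -> g y = RtoC 0) /\
    (forall x, In x X -> diag Z x < eta).
Proof.
  intros Heta; induction n as [|n IH]; intros E Rst HL HON.
  - destruct E; [|discriminate]. exists nil, nil; simpl.
    split; [exact HON|]. repeat split; try tauto.
  - destruct (classic (forall x, In x X -> diag E x < eta)) as [Hs|Hs].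
    + exists nil, E; simpl. split; [exact HON|]. repeat split; auto; tauto.
    + apply not_all_ex_not in Hs; destruct Hs as [y Hy].
      apply imply_to_and in Hy; destruct Hy as [HyX Hy].
      destruct E as [|f E]; [discriminate|]. injection HL; intros HL'.
      destruct (concentrate y E f Rst HON) as [f' [E' [H1 [H2 [H3 H4]]]]].
      destruct (IH E' (f' :: Rst)) as [P [Z [G1 [G2 [G3 [G4 [G5 G6]]]]]]].
      { congruence. }
      { eapply ON_perm; [|exact H1]. apply Permutation_middle. }
      exists ((f', y) :: P), Z. split; [|split; [|split; [|split; [|split]]]]; auto.
      * eapply ON_perm; [|exact G1]. simpl.
        rewrite !app_assoc. symmetry; apply Permutation_middle.
      * simpl in *; lia.
      * intros x z. rewrite <- H3. simpl. now rewrite !(kern_cons f'), G3.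
      * intros e z [Hez|Hez]; [|eauto].
        injection Hez; intros <- <-.
        (* Since [E'] vanishes at [y], the pivot [f'] carries the whole diagonal of the old family
           there. *)
        assert (Hd := diag_of_kern _ _ H3 y).
        unfold diag at 1 in Hd; rewrite lsum_cons in Hd; fold (diag E' y) in Hd.
        rewrite diag_zero_of_all in Hd by auto. lra.
      * intros e z g [Hez|Hez] Hg; [|eauto].
        injection Hez; intros <- <-.
        (* The diagonal at [y] is preserved by the later rotations and was zero for [E'], so each
           later vector vanishes at [y] too. *)
        assert (Hd := diag_of_kern _ _ G3 y).
        rewrite (diag_zero_of_all E') in Hd by auto.
        apply (diag_zero _ _ Hd); rewrite in_app_iff; tauto.
Qed.

Definition weight {T} (q : (T -> C) * T) : R := Cmod (fst q (snd q)) ^ 2.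

Lemma exists_heavy_pivot {T} (P : list ((T -> C) * T)) (t : R) :
  t * INR (length P) < lsum weight P -> exists q, In q P /\ t <= weight q.
Proof.
  intros H. apply NNPP; intros Hn.
  assert (lsum weight P <= lsum (fun _ => t) P).
  { apply lsum_le; intros q Hq. apply Rnot_lt_le; intros Hlt.
    apply Hn; exists q; split; auto; lra. }
  rewrite lsum_const in *; lra.
Qed.

(* A leftover vector vanishes at every pivot site, so rotating it with a pivot vector splits the pivot's weight exactly. *)
Lemma peel_weights {T} (eta : R) :
  0 < eta -> forall (Z : list (T -> C)) (P : list ((T -> C) * T)) Rst,
  ON (map fst P ++ Z ++ Rst) ->
  (forall q, In q P -> eta <= weight q) ->
  (forall e y g, In (e, y) P -> In g Z -> g y = RtoC 0) ->
  2 * eta * (INR (length P) + INR (length Z)) <= lsum weight P ->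
  exists E, ON (E ++ Rst) /\ (length E = length P + length Z)%nat /\
    (forall x z, kern E x z = kern (map fst P ++ Z) x z) /\
    (forall f, In f E -> exists x, eta <= Cmod (f x) ^ 2).
Proof.
  intros Heta; induction Z as [|g Z IH]; intros P Rst HON Hw Hv Hs.
  - exists (map fst P); rewrite app_nil_r, length_map.
    split; [exact HON|]. split; [simpl; lia|]. split; [reflexivity|].
    intros f Hf; apply in_map_iff in Hf; destruct Hf as [[e y] [<- Hq]].
    exists y; apply (Hw _ Hq).
  - change (length (g :: Z)) with (S (length Z)) in Hs; rewrite S_INR in Hs.
    assert (HZ := pos_INR (length Z)).
    (* The average pivot weight exceeds [2 * eta], so some pivot can give away [eta] and still keep
       [eta]. *)
    destruct (exists_heavy_pivot P (2 * eta)) as [[e y] [Hq Ht]]; [nra|].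
    set (t := weight (e, y)) in *.
    destruct (in_split _ _ Hq) as [P1 [P2 ->]].
    (* The angle is chosen so that [g'] receives weight exactly [eta] at [y] and the pivot keeps
       [t - eta]. *)
    set (b := sqrt (eta / t)); set (a := sqrt (1 - eta / t)).
    assert (Hb0 : 0 <= eta / t) by (apply Rdiv_le_0_compat; lra).
    assert (Ha0 : 0 <= 1 - eta / t).
    { assert (eta / t <= 1) by (apply Rle_div_l; lra). lra. }
    assert (Hb : b ^ 2 = eta / t) by (apply pow2_sqrt; lra).
    assert (Ha : a ^ 2 = 1 - eta / t) by (apply pow2_sqrt; lra).
    assert (Hab : Cmod (RtoC a) ^ 2 + Cmod (RtoC b) ^ 2 = 1).
    { rewrite !Cmod_R, !pow2_abs, Ha, Hb; ring. }
    set (e' := fun x => Cplus (Cmult (RtoC a) (e x)) (Cmult (RtoC b) (g x))).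
    set (g' := fun x => Cplus (Cmult (Copp (Cconj (RtoC b))) (e x))
                              (Cmult (Cconj (RtoC a)) (g x))).
    assert (Hgy : g y = RtoC 0) by (eapply Hv; [exact Hq | now left]).
    assert (He'y : weight (e', y) = t - eta).
    { unfold weight, e'; cbn [fst snd]. rewrite Hgy.
      replace (Cplus _ _) with (Cmult (RtoC a) (e y)) by ring.
      rewrite Cmod_mult, Cmod_R, Rpow_mult_distr, pow2_abs, Ha.
      change (Cmod (e y) ^ 2) with t. field; lra. }
    assert (Hg'y : Cmod (g' y) ^ 2 = eta).
    { unfold g'. rewrite Hgy, Cconj_RtoC.
      replace (Cplus _ _) with (Copp (Cmult (RtoC b) (e y))) by ring.
      rewrite Cmod_opp, Cmod_mult, Cmod_R, Rpow_mult_distr, pow2_abs, Hb.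
      change (Cmod (e y) ^ 2) with t. field; lra. }
    assert (HP : Permutation (map fst (P1 ++ (e, y) :: P2) ++ (g :: Z) ++ Rst)
                   (e :: g :: map fst (P1 ++ P2) ++ Z ++ Rst)).
    { rewrite !map_app. simpl. rewrite <- !app_assoc. simpl.
      symmetry. etransitivity; [|apply Permutation_middle]. constructor.
      rewrite !app_assoc. etransitivity; [|apply Permutation_middle].
      rewrite <- !app_assoc. reflexivity. }
    assert (HON' := ON_perm _ _ HP HON).
    apply (rotation_ON e g _ (RtoC a) (RtoC b) Hab) in HON'.
    fold e' g' in HON'.
    destruct (IH (P1 ++ (e', y) :: P2) (g' :: Rst)) as [E [G1 [G2 [G3 G4]]]].
    + eapply ON_perm; [|exact HON'].
      rewrite !map_app. simpl. rewrite <- !app_assoc. simpl.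
      etransitivity; [|apply Permutation_middle]. constructor.
      rewrite !app_assoc. apply Permutation_middle.
    + intros q Hin. rewrite in_app_iff in Hin; destruct Hin as [Hin|[<-|Hin]].
      * apply Hw; rewrite in_app_iff; tauto.
      * rewrite He'y; lra.
      * apply Hw; rewrite in_app_iff; simpl; tauto.
    + intros e0 y0 h Hin Hh.
      rewrite in_app_iff in Hin; destruct Hin as [Hin|[Heq|Hin]].
      * apply (Hv e0 y0 h); [rewrite in_app_iff; tauto | now right].
      * injection Heq; intros <- <-. apply (Hv e y h); [exact Hq | now right].
      * apply (Hv e0 y0 h); [rewrite in_app_iff; simpl; tauto | now right].
    (* The total weight drops by [eta] while the required amount drops by [2 * eta], so the
       invariant survives. *)
    + rewrite lsum_app, lsum_cons in *. rewrite length_app in *; simpl length in *.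
      fold t in Hs. rewrite He'y. nra.
    + exists (g' :: E). split; [|split; [|split]].
      * eapply ON_perm; [|exact G1]. symmetry; apply Permutation_middle.
      * rewrite length_app in *; simpl in *; lia.
      * intros x z.
        transitivity (kern (e' :: g' :: map fst (P1 ++ P2) ++ Z) x z).
        { transitivity (kern (g' :: map fst (P1 ++ (e', y) :: P2) ++ Z) x z).
          - now rewrite !(kern_cons g'), G3.
          - apply kern_perm. etransitivity; [|apply perm_swap]. constructor.
            rewrite !map_app. simpl. rewrite <- !app_assoc. simpl.
            symmetry; apply Permutation_middle. }
        unfold e', g'. rewrite rotation_kern by exact Hab.
        symmetry. apply kern_perm.
        rewrite !map_app. simpl. rewrite <- !app_assoc. simpl.
        symmetry. etransitivity; [|apply Permutation_middle]. constructor.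
        rewrite !app_assoc. etransitivity; [|apply Permutation_middle].
        reflexivity.
      * intros f [<-|Hf]; [exists y; lra | auto].
Qed.

(* Pivots carry at least half of the mass on [X], and each has norm one, so at least an eighth of the vectors are pivots. *)
Lemma peaked_family {T} (X : list T) (eta0 : R) (E Rst : list (T -> C)) :
  0 < eta0 -> NoDup X -> ON (E ++ Rst) ->
  (forall x, In x X -> 2 * eta0 <= diag E x) ->
  INR (length E) / 4 <= lsum (diag E) X ->
  exists E', ON (E' ++ Rst) /\ length E' = length E /\
    (forall x z, kern E' x z = kern E x z) /\
    (forall f, In f E' -> exists x, eta0 / 16 <= Cmod (f x) ^ 2).
Proof.
  intros Heta HX HON HX2 Hs.
  destruct (greedy_pivots X eta0 Heta _ E Rst eq_refl HON)
    as [P [Z [H1 [H2 [H3 [H4 [H5 H6]]]]]]].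
  assert (HONP : ON (map fst P)) by (eapply ON_app_l, H1).
  assert (Hc : lsum (diag E) X / 2 <= INR (length P)).
  { rewrite <- (length_map fst P). eapply Rle_trans; [|apply (ON_diag_sum_le _ X HONP HX)].
    unfold Rdiv; rewrite Rmult_comm, <- lsum_scal. apply lsum_le; intros x Hx.
    assert (Hd := diag_of_kern _ _ H3 x). rewrite diag_app in Hd.
    specialize (H6 x Hx); specialize (HX2 x Hx). lra. }
  assert (HL : INR (length E) = INR (length P) + INR (length Z)) by (rewrite <- plus_INR; congruence).
  assert (HW : eta0 * INR (length P) <= lsum weight P).
  { rewrite Rmult_comm, <- lsum_const. apply lsum_le; intros [e y] Hq.
    now apply H4. }
  (* At least an eighth of the family are pivots of weight at least [eta0], so the total weight is
     at least [eta0 / 8] per vector, which is twice [eta0 / 16]. *)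
  destruct (peel_weights (eta0 / 16) ltac:(lra) Z P Rst H1) as [E' [G1 [G2 [G3 G4]]]].
  - intros [e y] Hq. specialize (H4 e y Hq). unfold weight; simpl in *; lra.
  - exact H5.
  - rewrite <- HL. nra.
  - exists E'; split; [exact G1|]; split; [lia|]; split; [|exact G4].
    intros; now rewrite G3, H3.
Qed.

(** * The lattice *)

Definition ldist (l c : list Z) : R :=
  fold_right Rmax 0 (map (fun p : Z * Z => IZR (Z.abs (fst p - snd p))) (combine l c)).

Lemma ldist_cons k l a c :
  ldist (k :: l) (a :: c) = Rmax (IZR (Z.abs (k - a))) (ldist l c).
Proof. reflexivity. Qed.

Lemma ldist_nonneg l c : 0 <= ldist l c.
Proof.
  revert c; induction l as [|k l IH]; intros [|a c]; try (unfold ldist; simpl; lra).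
  rewrite ldist_cons. eapply Rle_trans; [apply (IH c)|apply Rmax_r].
Qed.

Lemma ldist_self l : ldist l l = 0.
Proof.
  induction l as [|k l IH]; [reflexivity|].
  rewrite ldist_cons, IH, Z.sub_diag. apply Rmax_left; simpl; lra.
Qed.

Lemma ldist_sym l c : ldist l c = ldist c l.
Proof.
  revert c; induction l as [|k l IH]; intros [|a c]; try reflexivity.
  rewrite !ldist_cons, IH. do 2 f_equal; lia.
Qed.

(** [combine] truncates to the shorter list, so a short intermediate point could break the
    inequality; hence the length conditions. *)
Lemma ldist_triangle l c e :
  length l = length c -> length c = length e -> ldist l e <= ldist l c + ldist c e.
Proof.
  revert c e; induction l as [|k l IH]; intros [|a c] [|b e] H1 H2; try discriminate.
  - unfold ldist; simpl; lra.
  - rewrite !ldist_cons. injection H1; injection H2; intros H3 H4.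
    specialize (IH c e H4 H3).
    assert (IZR (Z.abs (k - b)) <= IZR (Z.abs (k - a)) + IZR (Z.abs (a - b))).
    { rewrite <- plus_IZR. apply IZR_le; lia. }
    assert (X1 := Rmax_l (IZR (Z.abs (k - a))) (ldist l c)).
    assert (X2 := Rmax_r (IZR (Z.abs (k - a))) (ldist l c)).
    assert (X3 := Rmax_l (IZR (Z.abs (a - b))) (ldist c e)).
    assert (X4 := Rmax_r (IZR (Z.abs (a - b))) (ldist c e)).
    apply Rmax_lub; lra.
Qed.

Lemma dist_ldist {d} (x y : Zd d) : linf_dist x y = ldist (proj1_sig x) (proj1_sig y).
Proof. reflexivity. Qed.

Lemma dist_nonneg {d} (x y : Zd d) : 0 <= linf_dist x y.
Proof. apply ldist_nonneg. Qed.

Lemma dist_self {d} (x : Zd d) : linf_dist x x = 0.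
Proof. apply ldist_self. Qed.

Lemma dist_sym {d} (x y : Zd d) : linf_dist x y = linf_dist y x.
Proof. apply ldist_sym. Qed.

Lemma dist_triangle {d} (x y z : Zd d) : linf_dist x z <= linf_dist x y + linf_dist y z.
Proof.
  destruct x as [x Hx], y as [y Hy], z as [z Hz]. apply ldist_triangle; simpl; congruence.
Qed.

Definition zrange (a : Z) (n : nat) : list Z :=
  a :: flat_map (fun j => (a + Z.of_nat (S j))%Z :: (a - Z.of_nat (S j))%Z :: nil) (seq 0 n).

Fixpoint box (c : list Z) (n : nat) : list (list Z) :=
  match c with
  | nil => nil :: nil
  | a :: c' => flat_map (fun k => map (cons k) (box c' n)) (zrange a n)
  end.

Lemma in_zrange a n k : (Z.abs (k - a) <= Z.of_nat n)%Z -> In k (zrange a n).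
Proof.
  intros H. destruct (Z.eq_dec k a) as [->|Hk]; [now left|right].
  apply in_flat_map. exists (Z.to_nat (Z.abs (k - a) - 1)). split.
  - apply in_seq; lia.
  - simpl. lia.
Qed.

Lemma length_zrange a n : length (zrange a n) = (2 * n + 1)%nat.
Proof.
  unfold zrange; simpl length.
  rewrite (flat_map_constant_length (c := 2)); [rewrite length_seq; lia|].
  reflexivity.
Qed.

Lemma in_box c n l : length l = length c -> ldist l c <= INR n -> In l (box c n).
Proof.
  revert l; induction c as [|a c IH]; intros [|k l] Hl Hd; try discriminate; [now left|].
  rewrite ldist_cons in Hd. cbn [box]. apply in_flat_map. exists k. split.
  - apply in_zrange. apply le_IZR. rewrite <- INR_IZR_INZ.
    eapply Rle_trans; [apply Rmax_l|exact Hd].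
  - apply in_map, IH; [now injection Hl|]. eapply Rle_trans; [apply Rmax_r|exact Hd].
Qed.

Lemma length_box c n : length (box c n) = ((2 * n + 1) ^ length c)%nat.
Proof.
  induction c as [|a c IH]; [reflexivity|].
  cbn [box]. rewrite (flat_map_constant_length (c := ((2 * n + 1) ^ length c)%nat)).
  - rewrite length_zrange. simpl. lia.
  - intros k _. now rewrite length_map.
Qed.

(** The exponential of the l1 distance factors over coordinates, which turns lattice sums into
    products of geometric series; the l1 distance is at most [d] times the maximum distance. *)
Fixpoint l1dist (l c : list Z) : R :=
  match l, c with
  | k :: l', a :: c' => IZR (Z.abs (k - a)) + l1dist l' c'
  | _, _ => 0
  end.

Lemma l1dist_le l c : l1dist l c <= INR (length c) * ldist l c.
Proof.
  revert c; induction l as [|k l IH]; intros c.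
  - apply Rmult_le_pos; [apply pos_INR|apply ldist_nonneg].
  - destruct c as [|a c]; [simpl; lra|].
    rewrite ldist_cons. change (length (a :: c)) with (S (length c)); rewrite S_INR.
    specialize (IH c). simpl l1dist.
    assert (X1 := Rmax_l (IZR (Z.abs (k - a))) (ldist l c)).
    assert (X2 := Rmax_r (IZR (Z.abs (k - a))) (ldist l c)).
    assert (X3 := pos_INR (length c)). nra.
Qed.

Lemma zrange_exp_sum (nu : R) a n : 0 < nu ->
  lsum (fun k => exp (- (nu * IZR (Z.abs (k - a))))) (zrange a n) <= 1 + 2 / (1 - exp (- nu)).
Proof.
  intros Hnu. set (q := exp (- nu)).
  assert (Hq0 : 0 < q) by apply exp_pos.
  assert (Hq1 : q < 1) by (unfold q; rewrite <- exp_0; apply exp_increasing; lra).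
  assert (Hpow : forall j, exp (- (nu * INR j)) = q ^ j).
  { induction j as [|j IH]; [simpl; rewrite Rmult_0_r, Ropp_0; apply exp_0|].
    rewrite S_INR. replace (- (nu * (INR j + 1))) with (- nu + - (nu * INR j)) by ring.
    rewrite exp_plus, IH; reflexivity. }
  unfold zrange. rewrite lsum_cons, lsum_flat_map.
  replace (exp (- (nu * IZR (Z.abs (a - a))))) with 1.
  2:{ rewrite Z.sub_diag. simpl. rewrite Rmult_0_r, Ropp_0; symmetry; apply exp_0. }
  apply Rplus_le_compat_l.
  rewrite (lsum_ext _ (fun j => 2 * q * q ^ j)).
  - rewrite lsum_scal.
    assert (Hs : forall m s, (1 - q) * lsum (fun j => q ^ j) (seq s m) = q ^ s * (1 - q ^ m)).
    { induction m as [|m IH]; intros s; simpl seq.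
      - unfold lsum; simpl; ring.
      - rewrite lsum_cons, Rmult_plus_distr_l, IH. simpl; ring. }
    specialize (Hs n 0%nat). rewrite pow_O in Hs.
    assert (Hn : 0 <= q ^ n) by (apply pow_le; lra).
    set (t := lsum (fun j => q ^ j) (seq 0 n)) in *.
    assert (Ht : t <= 1 / (1 - q)) by (apply Rle_div_r; nra).
    assert (0 < 1 / (1 - q)) by (apply Rdiv_lt_0_compat; lra).
    replace (2 / (1 - q)) with (2 * (1 / (1 - q))) by (field; lra). nra.
  - intros j _. unfold lsum; cbn [map fold_right].
    replace (Z.abs (a + Z.of_nat (S j) - a)) with (Z.of_nat (S j)) by lia.
    replace (Z.abs (a - Z.of_nat (S j) - a)) with (Z.of_nat (S j)) by lia.
    rewrite <- INR_IZR_INZ, Hpow. simpl; ring.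
Qed.

Lemma box_exp_sum (nu : R) c n : 0 < nu ->
  lsum (fun l => exp (- (nu * l1dist l c))) (box c n) <=
  (1 + 2 / (1 - exp (- nu))) ^ length c.
Proof.
  intros Hnu. induction c as [|a c IH].
  - unfold lsum; simpl. rewrite Rmult_0_r, Ropp_0, exp_0; lra.
  - cbn [box]. rewrite lsum_flat_map.
    rewrite (lsum_ext _ (fun k => lsum (fun l => exp (- (nu * l1dist l c))) (box c n) *
                                exp (- (nu * IZR (Z.abs (k - a)))))).
    + rewrite lsum_scal. simpl pow. rewrite Rmult_comm.
      apply Rmult_le_compat.
      * apply lsum_nonneg; intros; left; apply exp_pos.
      * apply lsum_nonneg; intros; left; apply exp_pos.
      * now apply zrange_exp_sum.
      * exact IH.
    + intros k _. rewrite lsum_map, Rmult_comm, <- lsum_scal. apply lsum_ext; intros l _.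
      rewrite <- exp_plus. f_equal. simpl; ring.
Qed.

Lemma NoDup_proj1 {d} (F : list (Zd d)) : NoDup F -> NoDup (map (@proj1_sig _ _) F).
Proof.
  intros H. apply FinFun.Injective_map_NoDup; [|exact H].
  intros [x Hx] [y Hy] E; simpl in E. apply subset_eq_compat, E.
Qed.

Lemma exp_sum_bound (d : nat) (mu : R) : 0 < mu ->
  exists S0, 1 <= S0 /\ forall (z : Zd d) F, NoDup F ->
    lsum (fun x => exp (- (mu * linf_dist x z))) F <= S0.
Proof.
  (* Dividing by [d + 1] instead of [d] covers dimension zero. *)
  intros Hmu. set (nu := mu / (INR d + 1)).
  assert (Hd := pos_INR d).
  assert (Hnu : 0 < nu) by (apply Rdiv_lt_0_compat; lra).
  assert (Hq1 : exp (- nu) < 1) by (rewrite <- exp_0; apply exp_increasing; lra).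
  exists ((1 + 2 / (1 - exp (- nu))) ^ d). split.
  { apply pow_R1_Rle. assert (0 < 2 / (1 - exp (- nu))); [|lra].
    apply Rdiv_lt_0_compat; lra. }
  intros z F HF.
  assert (Hn : exists n : nat, forall x, In x F -> linf_dist x z <= INR n).
  { clear HF. induction F as [|x F [n IH]]; [now exists 0%nat|].
    destruct (INR_unbounded (linf_dist x z)) as [k Hk].
    exists (n + k)%nat; rewrite plus_INR. assert (Y1 := pos_INR n). assert (Y2 := pos_INR k).
    intros y [<-|Hy]; [lra|]. specialize (IH y Hy); lra. }
  destruct Hn as [n Hn].
  destruct z as [c Hc]. rewrite <- Hc at 2.
  eapply Rle_trans; [|apply (box_exp_sum nu c n Hnu)].
  apply Rle_trans with (lsum (fun l => exp (- (nu * l1dist l c))) (map (@proj1_sig _ _) F)).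
  - rewrite lsum_map. apply lsum_le; intros x Hx.
    assert (Hle : nu * l1dist (proj1_sig x) c <= mu * ldist (proj1_sig x) c).
    { assert (H1 := l1dist_le (proj1_sig x) c). rewrite Hc in H1.
      assert (H2 := ldist_nonneg (proj1_sig x) c).
      apply Rle_trans with (nu * ((INR d + 1) * ldist (proj1_sig x) c)).
      - apply Rmult_le_compat_l; lra.
      - unfold nu; apply Req_le; field; lra. }
    rewrite dist_ldist; simpl proj1_sig.
    destruct Hle as [Hlt|Heq]; [left; apply exp_increasing; lra|right; f_equal; lra].
  - apply lsum_incl; [now apply NoDup_proj1| |intros; left; apply exp_pos].
    intros l Hl. apply in_map_iff in Hl; destruct Hl as [x [<- Hx]].
    apply in_box; [|now apply Hn]. rewrite Hc; apply (proj2_sig x).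
Qed.

Lemma ball_volume {d} (z : Zd d) (r : R) F :
  0 <= r -> NoDup F -> (forall x, In x F -> linf_dist x z <= r) ->
  INR (length F) <= (2 * r + 3) ^ d.
Proof.
  intros Hr HF Hin. destruct (archimed r) as [H1 H2].
  assert (Hup : (0 <= up r)%Z) by (apply le_IZR; lra).
  (* [up r] is at most [r + 1], so a box side [2 n + 1] is at most [2 r + 3]. *)
  set (n := Z.to_nat (up r)).
  assert (Hn : INR n = IZR (up r)) by (unfold n; rewrite INR_IZR_INZ, Z2Nat.id; auto).
  destruct z as [c Hc].
  assert (HL : (length (map (@proj1_sig _ _) F) <= length (box c n))%nat).
  { apply NoDup_incl_length; [now apply NoDup_proj1|].
    intros l Hl. apply in_map_iff in Hl; destruct Hl as [x [<- Hx]].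
    apply in_box; [rewrite Hc; apply (proj2_sig x)|].
    specialize (Hin x Hx). rewrite dist_ldist in Hin; simpl in Hin. lra. }
  rewrite length_map, length_box, Hc in HL. apply le_INR in HL.
  eapply Rle_trans; [exact HL|]. rewrite pow_INR. apply pow_incr. split; [apply pos_INR|].
  rewrite plus_INR, mult_INR, Hn. simpl. lra.
Qed.

(** A maximal duplicate-free list of points of the ball exists by the volume bound, and maximality
    makes it exhaust the ball. *)
Lemma ball_list {d} (z : Zd d) (r : R) : 0 <= r ->
  exists B : list (Zd d), NoDup B /\ (forall x, In x B <-> linf_dist x z <= r) /\
    INR (length B) <= (2 * r + 3) ^ d.
Proof.
  intros Hr. destruct (INR_unbounded ((2 * r + 3) ^ d)) as [N HN].
  destruct (bounded_maximal_list
    (fun l => NoDup l /\ forall x, In x l -> linf_dist x z <= r) N) as [B [[HB1 HB2] HB3]].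
  - split; [constructor|]. simpl; tauto.
  - intros l [H1 H2]. apply INR_le. assert (H := ball_volume z r l Hr H1 H2). lra.
  - exists B; split; [exact HB1|split].
    + intros x; split; [apply HB2|]. intros Hx. apply NNPP; intros Hn.
      apply (HB3 x). split; [now constructor|]. intros y [<-|Hy]; auto.
    + now apply ball_volume with z.
Qed.

(** * Clusters of sites *)

Definition ind (Q : Prop) : R := if excluded_middle_informative Q then 1 else 0.

Lemma ind_true (Q : Prop) : Q -> ind Q = 1.
Proof. intros H; unfold ind; destruct (excluded_middle_informative Q); tauto. Qed.

Lemma ind_false (Q : Prop) : ~ Q -> ind Q = 0.
Proof. intros H; unfold ind; destruct (excluded_middle_informative Q); tauto. Qed.

Lemma ind_bounds (Q : Prop) : 0 <= ind Q <= 1.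
Proof. unfold ind; destruct (excluded_middle_informative Q); lra. Qed.

Lemma lsum_selectP {T} (Q : T -> Prop) (f : T -> R) l :
  lsum f (selectP Q l) = lsum (fun x => ind (Q x) * f x) l.
Proof.
  induction l as [|x l IH]; [reflexivity|].
  rewrite lsum_cons, <- IH. unfold selectP, ind; simpl.
  destruct (excluded_middle_informative (Q x)); rewrite ?lsum_cons; ring.
Qed.

(* A class of [n] points has diameter at most [(n - 1) s]; the [+ s] on the left makes the bound additive when classes merge. *)
Lemma clustering {T : Type} (D : T -> T -> R) (s : R) :
  0 < s -> (forall x, D x x = 0) -> (forall x y, D x y = D y x) ->
  (forall x y z, D x z <= D x y + D y z) ->
  forall Y : list T, NoDup Y ->
  exists lab : T -> nat,
    (forall x, In x Y -> (lab x < length Y)%nat) /\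
    (forall x y, In x Y -> In y Y -> D x y <= s -> lab x = lab y) /\
    (forall x y, In x Y -> In y Y -> lab x = lab y ->
      D x y + s <= s * lsum (fun z => ind (lab z = lab x)) Y).
Proof.
  intros Hs D0 Dsym Dtri; induction Y as [|y Y IH]; intros HN.
  - exists (fun _ => 0%nat); simpl; tauto.
  - inversion HN as [|y' Y' HyY HNY]; subst.
    destruct (IH HNY) as [lab [L1 [L2 L3]]].
    (* The new point [y] fuses with every class that has a member within [s] of it; the fused class
       gets the fresh label [length Y]. *)
    set (touched := fun z => z = y \/ exists x, In x Y /\ D x y <= s /\ lab x = lab z).
    set (lab' := fun z => if excluded_middle_informative (touched z) then length Y else lab z).
    assert (Lt : forall z, touched z -> lab' z = length Y).
    { intros z Hz; unfold lab'; destruct (excluded_middle_informative (touched z)); tauto. }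
    assert (Ln : forall z, ~ touched z -> lab' z = lab z).
    { intros z Hz; unfold lab'; destruct (excluded_middle_informative (touched z)); tauto. }
    assert (Hy : touched y) by now left.
    assert (Hin : forall z, In z (y :: Y) -> ~ touched z -> In z Y).
    { intros z [<-|Hz] Hnt; tauto. }
    assert (Hcl : forall z w, In z Y -> In w Y -> lab z = lab w -> touched z -> touched w).
    { intros z w Hz Hw Hzw [->|[x [Hx1 [Hx2 Hx3]]]]; [tauto|].
      right; exists x; repeat split; auto; congruence. }
    assert (Hdist : forall z, In z Y -> touched z ->
      D z y <= s * lsum (fun w => ind (lab w = lab z)) Y).
    { intros z Hz [->|[x [Hx1 [Hx2 Hx3]]]]; [tauto|].
      assert (H := L3 z x Hz Hx1 (eq_sym Hx3)).
      assert (H' := Dtri z x y). lra. }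
    assert (Hsame : forall z w, In z (y :: Y) -> In w (y :: Y) -> lab' z = lab' w ->
      touched z -> touched w).
    { intros z w Hz Hw Hzw Ht. apply NNPP; intros Hnt.
      rewrite (Lt z Ht), (Ln w Hnt) in Hzw.
      specialize (L1 w (Hin w Hw Hnt)); lia. }
    exists lab'; split; [|split].
    + intros x Hx. destruct (classic (touched x)) as [Ht|Ht].
      * rewrite (Lt x Ht); simpl; lia.
      * rewrite (Ln x Ht). specialize (L1 x (Hin x Hx Ht)); simpl; lia.
    + assert (Hone : forall x, In x Y -> D x y <= s -> touched x).
      { intros x Hx Hd; right; exists x; auto. }
      intros x z [<-|Hx] [<-|Hz] Hd; auto.
      * rewrite (Lt y Hy), Lt; auto. apply Hone; auto. now rewrite Dsym.
      * rewrite (Lt y Hy), Lt; auto.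
      * assert (E := L2 x z Hx Hz Hd).
        destruct (classic (touched x)) as [Ht|Ht].
        -- rewrite (Lt x Ht), Lt; auto. now apply Hcl with x.
        -- rewrite (Ln x Ht), Ln; auto. intros Ht'; apply Ht. now apply Hcl with z.
    + intros x z Hx Hz Hxz. rewrite lsum_cons.
      destruct (classic (touched x)) as [Ht|Ht].
      * assert (Ht' := Hsame x z Hx Hz Hxz Ht).
        rewrite (Lt x Ht). rewrite ind_true by now apply Lt.
        assert (Hle1 : forall w, In w Y -> touched w ->
          lsum (fun v => ind (lab v = lab w)) Y <= lsum (fun v => ind (lab' v = length Y)) Y).
        { intros w Hw Htw. apply lsum_le; intros v Hv.
          destruct (classic (lab v = lab w)) as [E|E].
          - rewrite (ind_true _ E), ind_true; [lra|]. apply Lt. now apply Hcl with w.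
          - rewrite (ind_false _ E). apply ind_bounds. }
        assert (Hpos : 0 <= lsum (fun v => ind (lab' v = length Y)) Y).
        { apply lsum_nonneg; intros; apply ind_bounds. }
        destruct Hx as [<-|Hx]; destruct Hz as [<-|Hz].
        -- rewrite D0; nra.
        -- rewrite Dsym. assert (H1 := Hdist z Hz Ht'). assert (H2 := Hle1 z Hz Ht'). nra.
        -- assert (H1 := Hdist x Hx Ht). assert (H2 := Hle1 x Hx Ht). nra.
        -- destruct (Nat.eq_dec (lab x) (lab z)) as [E|E].
           ++ assert (H1 := L3 x z Hx Hz E). assert (H2 := Hle1 x Hx Ht). nra.
           ++ assert (H1 := Hdist x Hx Ht). assert (H2 := Hdist z Hz Ht').
              assert (H3 := Dtri x y z). rewrite (Dsym y z) in H3.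
              (* Two distinct old classes joined through [y]: they are disjoint, so their counts add
                 up, and [y] itself supplies the extra [s]. *)
              assert (H4 : lsum (fun v => ind (lab v = lab x)) Y +
                lsum (fun v => ind (lab v = lab z)) Y <=
                lsum (fun v => ind (lab' v = length Y)) Y).
              { rewrite <- lsum_plus. apply lsum_le; intros v Hv.
                destruct (Nat.eq_dec (lab v) (lab x)) as [E1|E1];
                destruct (Nat.eq_dec (lab v) (lab z)) as [E2|E2]; try congruence.
                - rewrite (ind_true _ E1), (ind_false _ E2), ind_true; [lra|].
                  apply Lt. now apply Hcl with x.
                - rewrite (ind_false _ E1), (ind_true _ E2), ind_true; [lra|].
                  apply Lt. now apply Hcl with z.
                - rewrite (ind_false _ E1), (ind_false _ E2).
                  assert (H := ind_bounds (lab' v = length Y)); lra. }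
              nra.
      * assert (Ht' : ~ touched z).
        { intros Ht'; apply Ht. apply (Hsame z x); auto. }
        assert (Hx' := Hin x Hx Ht). assert (Hz' := Hin z Hz Ht').
        assert (E : lab x = lab z) by (rewrite <- (Ln x Ht), <- (Ln z Ht'); exact Hxz).
        assert (H1 := L3 x z Hx' Hz' E).
        assert (H2 : lsum (fun v => ind (lab v = lab x)) Y <=
          lsum (fun v => ind (lab' v = lab' x)) Y).
        { apply lsum_le; intros v Hv.
          destruct (Nat.eq_dec (lab v) (lab x)) as [E1|E1].
          - rewrite (ind_true _ E1), ind_true; [lra|].
            rewrite (Ln x Ht), Ln; auto. intros Hv'; apply Ht. now apply Hcl with v.
          - rewrite (ind_false _ E1). apply ind_bounds. }
        assert (H3 := ind_bounds (lab' y = lab' x)). nra.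
Qed.

Definition exp_summable (d : nat) (mu S0 : R) : Prop :=
  forall (z : Zd d) F, NoDup F -> lsum (fun x => exp (- (mu * linf_dist x z))) F <= S0.

Lemma exp_le_mono a b : a <= b -> exp a <= exp b.
Proof. intros [H| ->]; [left; now apply exp_increasing|lra]. Qed.

(** The rate is split: [mu] pays for summability and the remaining [nu - mu] gives the decay in the
    radius. *)
Lemma lsum_exp_tail {d} (mu nu S0 r : R) (z : Zd d) F :
  exp_summable d mu S0 -> 0 <= mu <= nu -> NoDup F ->
  (forall x, In x F -> r <= linf_dist x z) ->
  lsum (fun x => exp (- (nu * linf_dist x z))) F <= S0 * exp (- ((nu - mu) * r)).
Proof.
  intros HS [Hmu Hnu] HF Hr.
  apply Rle_trans with
    (lsum (fun x => exp (- ((nu - mu) * r)) * exp (- (mu * linf_dist x z))) F).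
  - apply lsum_le; intros x Hx. rewrite <- exp_plus. apply exp_le_mono.
    specialize (Hr x Hx). nra.
  - rewrite lsum_scal, Rmult_comm. apply Rmult_le_compat_r; [left; apply exp_pos|now apply HS].
Qed.

(** In [P(x,x) = sum_y |P(x,y)|^2], sites in the ball are bounded by Cauchy-Schwarz and the others
    by the decay of [P]. So either [x] carries very little mass or its ball carries a fixed
    amount. *)
Lemma diag_le_ball_mass {d} (E : list (vec d)) (c L S0 r : R) (x : Zd d) B :
  0 < c -> ON E -> exp_summable d (c / 8) S0 ->
  (forall x y, Cmod (kern E x y) <= exp (L - c * linf_dist x y)) ->
  NoDup B -> (forall y, linf_dist y x <= r -> In y B) -> 0 <= r ->
  diag E x <= diag E x * lsum (diag E) B + S0 * exp (2 * L - c * r).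
Proof.
  intros Hc HON HS Hdec HB HBin Hr.
  apply (HasSum_real_le _ _ _ (ON_kern_row E x HON)); intros F HF.
  rewrite (lsum_perm _ _ _ (selectP_split (fun y => In y B) F)), lsum_app.
  apply Rplus_le_compat.
  - apply Rle_trans with (lsum (fun y => diag E x * diag E y) (selectP (fun y => In y B) F)).
    + apply lsum_le; intros; apply kern_cauchy_schwarz.
    + rewrite lsum_scal. apply Rmult_le_compat_l; [apply diag_nonneg|].
      apply lsum_incl; [now apply NoDup_selectP| |intros; apply diag_nonneg].
      intros y Hy; now apply in_selectP in Hy.
  - set (G := selectP (fun y => ~ In y B) F).
    assert (HG : forall y, In y G -> r <= linf_dist y x).
    { intros y Hy; apply in_selectP in Hy; destruct Hy as [_ Hy].
      apply Rnot_lt_le; intros Hlt; apply Hy, HBin; lra. }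
    assert (HS' := lsum_exp_tail (c / 8) (2 * c) S0 r x G HS ltac:(lra)
      (NoDup_selectP _ _ HF) HG).
    apply Rle_trans with (exp (2 * L) * lsum (fun y => exp (- (2 * c * linf_dist y x))) G).
    + rewrite <- lsum_scal. apply lsum_le; intros y _.
      rewrite <- exp_plus.
      replace (2 * L + - (2 * c * linf_dist y x)) with
        ((L - c * linf_dist x y) + (L - c * linf_dist x y)) by (rewrite (dist_sym x y); ring).
      rewrite exp_plus. assert (H := Hdec x y). assert (H' := Cmod_ge_0 (kern E x y)). simpl; nra.
    + apply Rle_trans with (exp (2 * L) * (S0 * exp (- ((2 * c - c / 8) * r)))).
      * apply Rmult_le_compat_l; [left; apply exp_pos|exact HS'].
      * replace (exp (2 * L) * (S0 * exp (- ((2 * c - c / 8) * r)))) with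
          (S0 * exp (2 * L + - ((2 * c - c / 8) * r))) by (rewrite exp_plus; ring).
        apply Rmult_le_compat_l; [|apply exp_le_mono; nra].
        assert (H := HS x nil (NoDup_nil _)). exact H.
Qed.

Definition ball {d} (r : R) (Hr : 0 <= r) (z : Zd d) : list (Zd d) :=
  proj1_sig (constructive_indefinite_description _ (ball_list z r Hr)).

Lemma ball_NoDup {d} r Hr (z : Zd d) : NoDup (ball r Hr z).
Proof. unfold ball; destruct constructive_indefinite_description; simpl; tauto. Qed.

Lemma in_ball {d} r Hr (z x : Zd d) : In x (ball r Hr z) <-> linf_dist x z <= r.
Proof. unfold ball; destruct constructive_indefinite_description as [B [H1 [H2 H3]]]; apply H2. Qed.

Lemma length_ball {d} r Hr (z : Zd d) : INR (length (ball r Hr z)) <= (2 * r + 3) ^ d.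
Proof. unfold ball; destruct constructive_indefinite_description; simpl; tauto. Qed.

Lemma NoDup_flat_map {T U} (g : T -> list U) (Y : list T) :
  (forall y, NoDup (g y)) -> ForallOrdPairs (fun x y => forall u, In u (g x) -> ~ In u (g y)) Y ->
  NoDup (flat_map g Y).
Proof.
  intros Hg. induction 1 as [|y Y Hy HY IH]; [constructor|].
  simpl. apply NoDup_app; auto.
  intros u Hu Hu'. apply in_flat_map in Hu'; destruct Hu' as [z [Hz Huz]].
  rewrite Forall_forall in Hy. exact (Hy z Hz u Hu Huz).
Qed.

(** For a maximal family with distances above [2 r] the balls of radius [r] are disjoint. Each has
    mass at least 1/2, which bounds their number; maximality gives the covering. *)
Lemma separated_net {d} (Q : Zd d -> Prop) (p : Zd d -> R) (r M : R) (Hr : 0 <= r) :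
  (forall x, 0 <= p x) -> (forall F, NoDup F -> lsum p F <= M) ->
  (forall x, Q x -> 1 / 2 <= lsum p (ball r Hr x)) ->
  exists Y, NoDup Y /\ (forall y, In y Y -> Q y) /\ INR (length Y) <= 2 * M /\
    (forall x, Q x -> exists y, In y Y /\ linf_dist x y <= 2 * r).
Proof.
  intros Hp HM Hmass.
  set (good := fun Y => (forall y, In y Y -> Q y) /\
     ForallOrdPairs (fun x y : Zd d => 2 * r < linf_dist x y) Y).
  assert (Hlen : forall Y, good Y -> INR (length Y) <= 2 * M).
  { intros Y [HQ HY].
    assert (HN : NoDup (flat_map (ball r Hr) Y)).
    { apply NoDup_flat_map; [apply ball_NoDup|].
      clear HQ. induction HY as [|y Y Hy HY IH]; constructor; auto.
      rewrite Forall_forall in *. intros z Hz u Hu Hu'. specialize (Hy z Hz).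
      apply in_ball in Hu; apply in_ball in Hu'.
      assert (H := dist_triangle y u z). rewrite (dist_sym y u) in H. lra. }
    specialize (HM _ HN). rewrite lsum_flat_map in HM.
    assert (lsum (fun _ => 1 / 2) Y <= lsum (fun x => lsum p (ball r Hr x)) Y).
    { apply lsum_le; intros; apply Hmass; auto. }
    rewrite lsum_const in *. lra. }
  destruct (INR_unbounded (2 * M)) as [N HN].
  destruct (bounded_maximal_list good N) as [Y [HY Hmax]].
  - split; [simpl; tauto|constructor].
  - intros Y HY; apply INR_le. specialize (Hlen Y HY); lra.
  - exists Y; split; [|split; [|split]].
    + destruct HY as [_ HY]. clear Hmax. induction HY as [|y Y Hy HY IH]; constructor; auto.
      intros Hin. rewrite Forall_forall in Hy. specialize (Hy y Hin).
      rewrite dist_self in Hy; lra.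
    + apply HY.
    + now apply Hlen.
    + intros x Hx. apply NNPP; intros Hn. apply (Hmax x). destruct HY as [HY1 HY2].
      split; [intros z [<-|Hz]; auto|]. constructor; auto.
      apply Forall_forall; intros y Hy. apply Rnot_le_lt; intros Hle.
      apply Hn; exists y; auto.
Qed.

(** * Localization of eigenfunctions *)

(** Weights for the maximum principle: applying a kernel of size [exp(- c/2 |x - y|)] to a function
    bounded by [w] costs only the factor [S0]. The weight 1 locates the maximum, the weight [Phi]
    yields the decay. *)
Definition admissible {d} (c S0 : R) (w : Zd d -> R) : Prop :=
  (forall x, 0 < w x) /\
  forall y F, NoDup F ->
    lsum (fun x => exp (- (c / 2 * linf_dist x y)) * w x) F <= S0 * w y.

(** A smooth substitute for [exp(- c/8 dist(x, K))], equal to it up to the factor [length K]; being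
    a sum, it is admissible term by term. *)
Definition Phi {d} (c : R) (K : list (Zd d)) (x : Zd d) : R :=
  lsum (fun z => exp (- (c / 8 * linf_dist x z))) K.

Lemma admissible_one {d} (c S0 : R) :
  0 < c -> exp_summable d (c / 8) S0 -> admissible c S0 (fun _ : Zd d => 1).
Proof.
  intros Hc HS; split; [intros; lra|]. intros y F HF.
  eapply Rle_trans; [|rewrite Rmult_1_r; apply (HS y F HF)].
  apply lsum_le; intros x _. rewrite Rmult_1_r. apply exp_le_mono.
  assert (H := dist_nonneg x y). nra.
Qed.

Lemma Phi_ge {d} c (K : list (Zd d)) x z :
  In z K -> exp (- (c / 8 * linf_dist x z)) <= Phi c K x.
Proof.
  intros Hz. apply (lsum_ge_one (fun z => exp (- (c / 8 * linf_dist x z)))); auto.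
  intros; left; apply exp_pos.
Qed.

Lemma Phi_ge_1 {d} c (K : list (Zd d)) x : In x K -> 1 <= Phi c K x.
Proof.
  intros Hx. assert (H := Phi_ge c K x x Hx).
  now rewrite dist_self, Rmult_0_r, Ropp_0, exp_0 in H.
Qed.

Lemma Phi_le_length {d} c (K : list (Zd d)) x : 0 < c -> Phi c K x <= INR (length K).
Proof.
  intros Hc. rewrite <- (Rmult_1_r (INR _)), <- lsum_const.
  apply lsum_le; intros z _. rewrite <- exp_0. apply exp_le_mono.
  assert (H := dist_nonneg x z). nra.
Qed.

Lemma Phi_nonneg {d} c (K : list (Zd d)) x : 0 <= Phi c K x.
Proof. apply lsum_nonneg; intros; left; apply exp_pos. Qed.

Lemma Phi_sum {d} c S0 (K F : list (Zd d)) :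
  exp_summable d (c / 8) S0 -> NoDup F -> lsum (Phi c K) F <= INR (length K) * S0.
Proof.
  intros HS HF. unfold Phi. rewrite lsum_swap, <- lsum_const.
  apply lsum_le; intros z _. now apply HS.
Qed.

(** By the triangle inequality, [c/8] of the kernel rate [c/2] moves the exponential from [x] to
    [y], and another [c/8] is kept for summing over [x]. *)
Lemma admissible_Phi {d} (c S0 : R) (K : list (Zd d)) z :
  0 < c -> exp_summable d (c / 8) S0 -> In z K -> admissible c S0 (Phi c K).
Proof.
  intros Hc HS Hz; split.
  - intros x. eapply Rlt_le_trans; [apply exp_pos|apply (Phi_ge c K x z Hz)].
  - intros y F HF. unfold Phi.
    rewrite (lsum_ext _ (fun x => lsum (fun z0 =>
      exp (- (c / 2 * linf_dist x y)) * exp (- (c / 8 * linf_dist x z0))) K))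
      by (intros; now rewrite lsum_scal).
    rewrite lsum_swap, <- lsum_scal. apply lsum_le; intros u _.
    apply Rle_trans with
      (lsum (fun x => exp (- (c / 8 * linf_dist y u)) * exp (- (c / 8 * linf_dist x y))) F).
    + apply lsum_le; intros x _. rewrite <- !exp_plus. apply exp_le_mono.
      assert (H1 := dist_triangle y x u). rewrite (dist_sym y x) in H1.
      assert (H2 := dist_nonneg x y). nra.
    + rewrite lsum_scal, Rmult_comm.
      apply Rmult_le_compat_r; [left; apply exp_pos|now apply HS].
Qed.

Lemma HasSum_weighted_le {d} (c S0 B M : R) (w : Zd d -> R) (k f : Zd d -> C) (s : C) y :
  admissible c S0 w -> 0 <= B -> 0 <= M ->
  HasSum (fun x => Cmult (k x) (f x)) s ->
  (forall x, Cmod (k x) <= B * exp (- (c / 2 * linf_dist x y))) ->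
  (forall x, Cmod (f x) <= M * w x) ->
  Cmod s <= B * M * S0 * w y.
Proof.
  intros [Hw Hadm] HB HM Hs Hk Hf. apply (HasSum_norm_le _ _ _ Hs); intros F HF.
  apply Rle_trans with
    (lsum (fun x => (B * M) * (exp (- (c / 2 * linf_dist x y)) * w x)) F).
  - apply lsum_le; intros x _. rewrite Cmod_mult.
    replace (B * M * (exp (- (c / 2 * linf_dist x y)) * w x)) with
      ((B * exp (- (c / 2 * linf_dist x y))) * (M * w x)) by ring.
    apply Rmult_le_compat; auto using Cmod_ge_0.
  - rewrite lsum_scal, (Rmult_assoc (B * M)). apply Rmult_le_compat_l; [|now apply Hadm].
    now apply Rmult_le_pos.
Qed.

(** The supremum over an infinite set need not be attained; a point reaching half of it costs a
    factor 2 in the arguments that use it. *)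
Lemma near_maximum {T} (g : T -> R) (M : R) x0 :
  (forall x, g x <= M) -> 0 < g x0 -> exists y, 0 < g y /\ forall x, g x <= 2 * g y.
Proof.
  intros HM H0.
  destruct (completeness (fun r => exists x, r = g x)) as [s [Hs1 Hs2]].
  - exists M; intros r [x ->]; apply HM.
  - exists (g x0), x0; reflexivity.
  - assert (Hs0 : g x0 <= s) by (apply Hs1; now exists x0).
    apply NNPP; intros Hn.
    assert (H : s <= s / 2); [|lra].
    apply Hs2; intros r [x ->]. apply Rnot_lt_le; intros Hlt. apply Hn.
    exists x; split; [lra|]. intros z.
    assert (g z <= s) by (apply Hs1; now exists z). lra.
Qed.

Lemma Cmod_INR_minus (n m : nat) (N : nat) :
  (n <= N)%nat -> (m <= N)%nat -> Cmod (Cminus (RtoC (INR n)) (RtoC (INR m))) <= INR N.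
Proof.
  intros Hn Hm. rewrite <- RtoC_minus, Cmod_R.
  apply le_INR in Hn, Hm. assert (H1 := pos_INR n). assert (H2 := pos_INR m).
  apply Rabs_le; lra.
Qed.

Lemma Cmod_INR_distinct (n m : nat) :
  n <> m -> 1 <= Cmod (Cminus (RtoC (INR n)) (RtoC (INR m))).
Proof.
  intros H. rewrite <- RtoC_minus, Cmod_R.
  destruct (Nat.lt_gt_cases n m) as [[Hl|Hl] _]; auto; apply le_INR in Hl; rewrite S_INR in Hl.
  - rewrite Rabs_left; lra.
  - rewrite Rabs_right; lra.
Qed.

(* [(lam - a y) f y = sum_x (a x - a y) P(y,x) f x], and the right-hand side only involves pairs for which [P] is small. *)
Lemma eigen_off_label {d} (E : list (vec d)) (c S0 beta M : R) (N : nat) (a : Zd d -> nat)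
  (f : vec d) (lam : C) (w : Zd d -> R) y :
  admissible c S0 w -> 0 <= beta -> 0 <= M -> ON E -> In f E ->
  (forall x, (a x <= N)%nat) ->
  (forall x y, a x <> a y -> Cmod (kern E x y) <= beta * exp (- (c / 2 * linf_dist x y))) ->
  (forall y, HasSum (fun x => Cmult (Cmult (RtoC (INR (a x))) (kern E y x)) (f x))
                    (Cmult lam (f y))) ->
  (forall x, Cmod (f x) <= M * w x) ->
  Cmod (Cminus lam (RtoC (INR (a y)))) * Cmod (f y) <= INR N * beta * M * S0 * w y.
Proof.
  intros Hadm Hb HM HON Hf Ha Hoff Heig Hfw.
  rewrite <- Cmod_mult.
  apply (HasSum_weighted_le c S0 (INR N * beta) M w
    (fun x => Cmult (Cminus (RtoC (INR (a x))) (RtoC (INR (a y)))) (kern E y x)) f); auto.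
  - apply Rmult_le_pos; auto using pos_INR.
  - apply HasSum_eq with
      (Cplus (Cmult lam (f y)) (Cmult (Copp (RtoC (INR (a y)))) (f y))); [|ring].
    eapply HasSum_ext; [|apply HasSum_plus;
      [apply Heig|apply HasSum_scal, (ON_reproducing E f y HON Hf)]].
    intros x; simpl; ring.
  - intros x. rewrite Cmod_mult.
    destruct (Nat.eq_dec (a x) (a y)) as [E1|E1].
    + rewrite E1. replace (Cminus _ _) with (RtoC 0) by ring. rewrite Cmod_0, Rmult_0_l.
      apply Rmult_le_pos; [|left; apply exp_pos]. apply Rmult_le_pos; auto using pos_INR.
    + rewrite Rmult_assoc. apply Rmult_le_compat; auto using Cmod_ge_0.
      * now apply Cmod_INR_minus.
      * rewrite Cmod_kern_sym. now apply Hoff.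
Qed.

(** The label [l] is read off at a near maximum of [|f|], which pins [lam] near [l] and separates it
    from all other labels. The maximum principle is then repeated for the ratio [|f| / Phi]: its
    near maximum must lie in [K l], where [|f| <= 1 <= Phi]. One more use of the off-label bound
    gives the last conclusion. *)
Lemma eigen_localized {d} (E : list (vec d)) (c S0 beta A : R) (N : nat) (a : Zd d -> nat)
  (K : nat -> list (Zd d)) (H : list (Zd d)) (f : vec d) (lam : C) :
  0 < c -> 1 <= S0 -> exp_summable d (c / 8) S0 -> ON E -> In f E -> 0 <= beta ->
  (forall x, (a x <= N)%nat) ->
  (forall l x, (1 <= l)%nat -> In x (K l) <-> a x = l) ->
  (forall x, a x <> 0%nat -> In x H) ->
  (forall x y, a x <> a y -> Cmod (kern E x y) <= beta * exp (- (c / 2 * linf_dist x y))) ->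
  (forall x y, a y = 0%nat -> Cmod (kern E x y) <= beta * exp (- (c / 2 * linf_dist x y))) ->
  (forall x y, Cmod (kern E x y) <= A * exp (- (c / 8 * linf_dist x y))) ->
  (forall y, HasSum (fun x => Cmult (Cmult (RtoC (INR (a x))) (kern E y x)) (f x))
                    (Cmult lam (f y))) ->
  8 * (INR N + 1) * beta * S0 < 1 ->
  exists l, (1 <= l)%nat /\ (l <= N)%nat /\ (exists x, a x = l) /\
    (forall y, Cmod (f y) <= 2 * Phi c (K l) y) /\
    (forall y, a y <> l -> Cmod (f y) <= 4 * INR N * beta * S0 * Phi c (K l) y).
Proof.
  intros Hc HS1 HS HON Hf Hb Ha HK HH Hoff Hlight Hcrude Heig Hsmall.
  assert (HN := pos_INR N).
  assert (HbS : 0 <= beta * S0) by nra.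
  assert (HNbS : 0 <= INR N * (beta * S0)) by nra.
  assert (Hunit := ON_in E f HON Hf).
  assert (Hf1 : forall x, Cmod (f x) <= 1) by (intros; now apply unit_pointwise_le).
  assert (Hx0 : exists x0, 0 < Cmod (f x0)).
  { apply NNPP; intros Hn.
    assert (H1 : 1 <= 0); [|lra].
    apply (HasSum_real_le _ _ _ (ip_self_real f Hunit)). intros F _.
    rewrite <- (Rmult_0_r (INR (length F))), <- lsum_const. apply lsum_le; intros x _.
    assert (H0 : ~ 0 < Cmod (f x)) by (intros Hx; apply Hn; now exists x).
    assert (H2 := Cmod_ge_0 (f x)). nra. }
  destruct Hx0 as [x0 Hx0].
  destruct (near_maximum (fun x => Cmod (f x)) 1 x0 Hf1 Hx0) as [y0 [Hy0 Hmax]].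
  assert (Hadm1 := admissible_one c S0 Hc HS).
  (* At a site of label 0 the whole column of [P] is small, so [P f = f] would make [|f y0|] smaller
     than itself. *)
  assert (Hl0 : a y0 <> 0%nat).
  { intros E0.
    assert (H1 : Cmod (f y0) <= beta * (2 * Cmod (f y0)) * S0 * 1).
    { apply (HasSum_weighted_le c S0 beta (2 * Cmod (f y0)) (fun _ => 1)
        (fun x => kern E y0 x) f (f y0) y0); auto; try lra.
      - now apply ON_reproducing.
      - intros x. rewrite Cmod_kern_sym. now apply Hlight.
      - intros x. specialize (Hmax x). simpl in *; lra. }
    nra. }
  set (l := a y0) in *.
  (* With the weight 1 and the bound [2 |f y0|] for [|f|], the factor [|f y0|] cancels. *)
  assert (Hlam : Cmod (Cminus lam (RtoC (INR l))) <= 1 / 4).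
  { assert (H1 := eigen_off_label E c S0 beta (2 * Cmod (f y0)) N a f lam (fun _ => 1) y0
      Hadm1 Hb ltac:(lra) HON Hf Ha Hoff Heig).
    assert (H2 : Cmod (Cminus lam (RtoC (INR l))) * Cmod (f y0) <=
      INR N * beta * (2 * Cmod (f y0)) * S0 * 1).
    { apply H1. intros x; specialize (Hmax x); simpl in *; lra. }
    apply Rmult_le_reg_r with (Cmod (f y0)); auto. nra. }
  assert (Hgap : forall y, a y <> l -> 3 / 4 <= Cmod (Cminus lam (RtoC (INR (a y))))).
  { intros y Hy. assert (H1 := Cmod_INR_distinct (a y) l Hy).
    assert (H2 := Cmod_triangle (Cminus (RtoC (INR (a y))) lam) (Cminus lam (RtoC (INR l)))).
    replace (Cplus (Cminus (RtoC (INR (a y))) lam) (Cminus lam (RtoC (INR l))))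
      with (Cminus (RtoC (INR (a y))) (RtoC (INR l))) in H2 by ring.
    replace (Cminus (RtoC (INR (a y))) lam) with (Copp (Cminus lam (RtoC (INR (a y))))) in H2 by ring.
    rewrite Cmod_opp in H2. lra. }
  assert (Hl1 : (1 <= l)%nat) by lia.
  assert (HyK : In y0 (K l)) by (now apply HK).
  assert (HadmP := admissible_Phi c S0 (K l) y0 Hc HS HyK).
  assert (HPpos := proj1 HadmP).
  assert (Hoffl : forall M, 0 <= M -> (forall x, Cmod (f x) <= M * Phi c (K l) x) ->
    forall y, a y <> l -> Cmod (f y) <= 2 * INR N * beta * M * S0 * Phi c (K l) y).
  { intros M HM HfM y Hy.
    assert (H1 := eigen_off_label E c S0 beta M N a f lam _ y HadmP Hb HM HON Hf Ha Hoff Heig HfM).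
    assert (H2 := Hgap y Hy). assert (H3 := Cmod_ge_0 (f y)). nra. }
  (* The ratio must be known to be bounded before a near maximum can be taken. The eigenvalue
     equation expresses [lam * f y] by a sum over the finite set [H], and [|lam| >= 3/4], so decay
     at rate [c/8] holds with a crude constant. *)
  assert (Hbdd : exists M, forall x, Cmod (f x) / Phi c (K l) x <= M).
  { assert (HA : 0 <= A).
    { assert (H1 := Hcrude y0 y0). assert (H2 := Cmod_ge_0 (kern E y0 y0)).
      rewrite dist_self, Rmult_0_r, Ropp_0, exp_0 in H1. lra. }
    set (B := INR N * A * lsum (fun x => exp (c / 8 * linf_dist x y0)) H).
    assert (Hlam2 : 3 / 4 <= Cmod lam).
    { assert (H2 := Cmod_triangle (Cminus (RtoC (INR l)) lam) lam).
      replace (Cplus (Cminus (RtoC (INR l)) lam) lam) with (RtoC (INR l)) in H2 by ring.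
      replace (Cminus (RtoC (INR l)) lam) with (Copp (Cminus lam (RtoC (INR l)))) in H2 by ring.
      rewrite Cmod_opp, Cmod_R, Rabs_pos_eq in H2 by apply pos_INR.
      apply le_INR in Hl1. simpl in Hl1. lra. }
    exists (2 * B). intros y.
    apply Rle_div_l; [apply HPpos|].
    assert (H1 : Cmod lam * Cmod (f y) <= B * exp (- (c / 8 * linf_dist y y0))).
    { rewrite <- Cmod_mult. apply (HasSum_norm_le _ _ _ (Heig y)); intros F HF.
      rewrite (lsum_perm _ _ _ (selectP_split (fun x => In x H) F)), lsum_app.
      set (tm := fun x => INR N * A * exp (c / 8 * linf_dist x y0) *
        exp (- (c / 8 * linf_dist y y0))).
      apply Rle_trans with (lsum tm (selectP (fun x => In x H) F) + 0).
      - apply Rplus_le_compat.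
        + apply lsum_le; intros x _. unfold tm. rewrite !Cmod_mult, Cmod_R, Rabs_pos_eq by apply pos_INR.
          assert (H2 : exp (- (c / 8 * linf_dist y x)) <=
            exp (c / 8 * linf_dist x y0) * exp (- (c / 8 * linf_dist y y0))).
          { rewrite <- exp_plus. apply exp_le_mono.
            assert (H3 := dist_triangle y x y0). nra. }
          assert (H3 : INR (a x) <= INR N) by (apply le_INR, Ha).
          assert (H4 := Hcrude y x). assert (H5 := Hf1 x).
          assert (H6 := Cmod_ge_0 (kern E y x)). assert (H7 := pos_INR (a x)).
          assert (H8 := Cmod_ge_0 (f x)).
          apply Rle_trans with (INR N * (A * (exp (c / 8 * linf_dist x y0) *
            exp (- (c / 8 * linf_dist y y0)))) * 1); [|lra].
          apply Rmult_le_compat; auto.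
          * apply Rmult_le_pos; auto.
          * apply Rmult_le_compat; auto.
            eapply Rle_trans; [exact H4|]. apply Rmult_le_compat_l; auto.
        + apply Req_le. rewrite (lsum_ext _ (fun _ => 0)).
          * rewrite lsum_const; ring.
          * intros x Hx. apply in_selectP in Hx; destruct Hx as [_ Hx].
            assert (a x = 0%nat) as -> by (apply NNPP; intros Hn; apply Hx, HH, Hn).
            simpl. rewrite !Cmod_mult, Cmod_0. ring.
      - rewrite Rplus_0_r. unfold B.
        apply Rle_trans with (lsum tm H).
        + apply lsum_incl; [now apply NoDup_selectP| |].
          * intros x Hx; now apply in_selectP in Hx.
          * intros x _. unfold tm. repeat apply Rmult_le_pos; auto; left; apply exp_pos.
        + unfold tm. apply Req_le.
          rewrite (lsum_ext _ (fun x => (exp (- (c / 8 * linf_dist y y0)) * (INR N * A)) *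
            exp (c / 8 * linf_dist x y0))) by (intros; ring).
          rewrite lsum_scal; ring. }
    assert (HB : 0 <= B).
    { unfold B. repeat apply Rmult_le_pos; auto. apply lsum_nonneg; intros; left; apply exp_pos. }
    assert (H2 := Phi_ge c (K l) y y0 HyK). assert (H3 := Cmod_ge_0 (f y)).
    assert (H4 : B * exp (- (c / 8 * linf_dist y y0)) <= B * Phi c (K l) y)
      by (now apply Rmult_le_compat_l).
    assert (H5 : 3 / 4 * Cmod (f y) <= Cmod lam * Cmod (f y)) by (now apply Rmult_le_compat_r).
    nra. }
  destruct Hbdd as [M HM].
  destruct (near_maximum (fun x => Cmod (f x) / Phi c (K l) x) M x0 HM) as [y1 [Hy1 Hmax1]].
  { apply Rdiv_lt_0_compat; auto. }
  set (t := Cmod (f y1) / Phi c (K l) y1) in *.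
  assert (Hft : forall x, Cmod (f x) <= 2 * t * Phi c (K l) x).
  { intros x. specialize (Hmax1 x). simpl in Hmax1.
    now apply (Rle_div_l _ _ _ (HPpos x)) in Hmax1. }
  (* Off the cluster, [Hoffl] would give [t <= 4 N beta S0 t], which is less than [t]. *)
  assert (Hy1K : a y1 = l).
  { apply NNPP; intros Hn.
    assert (H1 := Hoffl (2 * t) ltac:(lra) Hft y1 Hn).
    assert (H2 : Cmod (f y1) = t * Phi c (K l) y1).
    { unfold t; field. specialize (HPpos y1); lra. }
    assert (H3 : 0 < t * Phi c (K l) y1) by (apply Rmult_lt_0_compat; auto).
    rewrite H2 in H1. nra. }
  assert (Ht1 : t <= 1).
  { assert (H1 := Phi_ge_1 c (K l) y1 (proj2 (HK l y1 Hl1) Hy1K)).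
    apply Rle_div_l; [apply HPpos|]. specialize (Hf1 y1). lra. }
  assert (Hfin : forall y, Cmod (f y) <= 2 * Phi c (K l) y).
  { intros y. specialize (Hft y). specialize (HPpos y). nra. }
  exists l; split; [auto|split; [apply Ha|split; [now exists y0|split; [exact Hfin|]]]].
  intros y Hy. assert (H1 := Hoffl 2 ltac:(lra) Hfin y Hy). lra.
Qed.

(** * Concentration of mass *)

Lemma ON_selectP {T} (Q : (T -> C) -> Prop) (E : list (T -> C)) : ON E -> ON (selectP Q E).
Proof.
  intros H. eapply ON_app_l, ON_perm; [apply (selectP_split Q)|exact H].
Qed.

Lemma lsum_outside {T} (g : T -> R) (K F : list T) (M : R) :
  NoDup F -> (forall x, 0 <= g x) ->
  (forall G, NoDup G -> (forall x, In x G -> ~ In x K) -> lsum g G <= M) ->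
  lsum g F <= lsum g K + M.
Proof.
  intros HF Hg HM.
  rewrite (lsum_perm _ _ _ (selectP_split (fun x => In x K) F)), lsum_app.
  apply Rplus_le_compat.
  - apply lsum_incl; auto using NoDup_selectP.
    intros x Hx; now apply in_selectP in Hx.
  - apply HM; [now apply NoDup_selectP|]. intros x Hx; now apply in_selectP in Hx.
Qed.

(* [sum_(x,y in K) |E(x,y)|^2] is nearly the rank; far pairs and pairs of sites with small diagonal account for at most a quarter of it. *)
Lemma concentrated_mass {T} (E : list (T -> C)) (K : list T) (near : T -> T -> Prop)
  (V eta0 : R) :
  ON E -> NoDup K -> 0 < V -> eta0 = 1 / (16 * V) -> (1 <= length E)%nat ->
  (forall x y, near x y -> near y x) ->
  (forall G, NoDup G -> (forall x, In x G -> ~ In x K) -> lsum (diag E) G <= 1 / 8) ->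
  (forall x, In x K ->
    lsum (fun y => Cmod (kern E x y)) (selectP (fun y => ~ near x y) K) <= 1 / 8) ->
  (forall x, In x K -> INR (length (selectP (near x) K)) <= V) ->
  INR (length E) / 4 <= lsum (diag E) (selectP (fun x => 2 * eta0 <= diag E x) K).
Proof.
  intros HON HK HV Heta Hlen Hsym Hout Hfar Hnear.
  set (r := INR (length E)).
  assert (Hr : 1 <= r) by (apply (le_INR 1); exact Hlen).
  assert (Heta0 : 0 < eta0) by (rewrite Heta; apply Rdiv_lt_0_compat; lra).
  set (X := fun x => 2 * eta0 <= diag E x).
  assert (HsumK : r - 1 / 8 <= lsum (diag E) K).
  { assert (r <= lsum (diag E) K + 1 / 8); [|lra].
    apply (HasSum_real_le _ _ _ (ON_diag_trace E HON)); intros F HF.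
    apply lsum_outside; auto using diag_nonneg. }
  assert (HsumK' : lsum (diag E) K <= r) by now apply ON_diag_sum_le.
  assert (Hrow : forall x, diag E x * (7 / 8) <= lsum (fun y => Cmod (kern E x y) ^ 2) K).
  { intros x.
    assert (diag E x <= lsum (fun y => Cmod (kern E x y) ^ 2) K + diag E x * (1 / 8)); [|lra].
    apply (HasSum_real_le _ _ _ (ON_kern_row E x HON)); intros F HF.
    apply lsum_outside; auto; [intros; apply pow2_ge_0|].
    intros G HG HGK.
    apply Rle_trans with (lsum (fun y => diag E x * diag E y) G).
    - apply lsum_le; intros; apply kern_cauchy_schwarz.
    - rewrite lsum_scal. apply Rmult_le_compat_l; [apply diag_nonneg|auto]. }
  set (W := lsum (fun x => lsum (fun y => Cmod (kern E x y) ^ 2) K) K).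
  assert (HW : 3 / 4 * r <= W).
  { apply Rle_trans with (lsum (fun x => diag E x * (7 / 8)) K).
    - rewrite (lsum_ext _ (fun x => 7 / 8 * diag E x)) by (intros; ring).
      rewrite lsum_scal. lra.
    - apply lsum_le; intros x _; apply Hrow. }
  (* The symmetric matrix of a Schur test: the kernel for far pairs, the threshold [2 * eta0] for
     near ones. The value [eta0 = 1 / (16 V)] makes the near part of each row at most 1/8, so row
     sums are at most 1/4. *)
  set (t := fun x y => ind (~ near x y) * Cmod (kern E x y) + ind (near x y) * (2 * eta0)).
  assert (Htsym : forall x y, t x y = t y x).
  { intros x y; unfold t. rewrite (Cmod_kern_sym E x y).
    destruct (classic (near x y)) as [H|H].
    - rewrite !(ind_true (near _ _)), !(ind_false (~ near _ _)) by (auto || (intros Hn; apply Hn; auto)).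
      reflexivity.
    - assert (H' : ~ near y x) by auto.
      rewrite !(ind_false (near _ _)), !(ind_true (~ near _ _)) by auto. reflexivity. }
  assert (Ht0 : forall x y, 0 <= t x y).
  { intros x y; unfold t. assert (H1 := ind_bounds (near x y)). assert (H2 := ind_bounds (~ near x y)).
    assert (H3 := Cmod_ge_0 (kern E x y)). apply Rplus_le_le_0_compat; apply Rmult_le_pos; lra. }
  assert (Htsum : forall x, In x K -> lsum (t x) K <= 1 / 4).
  { intros x Hx; unfold t. rewrite lsum_plus.
    specialize (Hfar x Hx); specialize (Hnear x Hx).
    rewrite lsum_selectP in Hfar.
    rewrite <- (lsum_selectP (near x) (fun _ => 2 * eta0)), lsum_const.
    assert (INR (length (selectP (near x) K)) * (2 * eta0) <= V * (2 * eta0))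
      by (apply Rmult_le_compat_r; lra).
    replace (V * (2 * eta0)) with (1 / 8) in * by (rewrite Heta; field; lra). lra. }
  (* Pairs meeting [X] are charged to the first bracket. For the others, near pairs satisfy
     [|k|^2 <= p x * p y] with both factors below [2 * eta0], and far pairs satisfy
     [|k| <= (p x + p y) / 2], where [p] is the diagonal of [E]. *)
  assert (Hpt : forall x y, Cmod (kern E x y) ^ 2 <=
    (ind (X x) * Cmod (kern E x y) ^ 2 + ind (X y) * Cmod (kern E x y) ^ 2) +
    (t x y * (diag E x / 2) + t x y * (diag E y / 2))).
  { intros x y. set (k := Cmod (kern E x y)).
    assert (Hk0 : 0 <= k) by apply Cmod_ge_0.
    assert (Hcs : k ^ 2 <= diag E x * diag E y) by apply kern_cauchy_schwarz.
    assert (Hqx := diag_nonneg E x). assert (Hqy := diag_nonneg E y).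
    assert (Ht := Ht0 x y). assert (Hk2 := pow2_ge_0 k).
    assert (Hi := ind_bounds (X x)). assert (Hj := ind_bounds (X y)).
    assert (Hs : 0 <= t x y * (diag E x / 2) + t x y * (diag E y / 2)) by nra.
    destruct (classic (X x)) as [Hx|Hx]; [rewrite (ind_true _ Hx); nra|].
    destruct (classic (X y)) as [Hy|Hy]; [rewrite (ind_true _ Hy); nra|].
    rewrite (ind_false _ Hx), (ind_false _ Hy).
    unfold X in Hx, Hy. apply Rnot_le_lt in Hx, Hy.
    unfold t in Ht, Hs |- *. fold k in Ht, Hs |- *.
    destruct (classic (near x y)) as [Hn|Hn].
    - rewrite (ind_true _ Hn), (ind_false (~ near x y)) by tauto. nra.
    - rewrite (ind_false _ Hn), (ind_true (~ near x y)) by tauto.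
      assert (Hav : k <= (diag E x + diag E y) / 2).
      2:{ apply (Rmult_le_compat_l k) in Hav; auto. lra. }
      apply Rnot_lt_le; intros Hlt.
      assert (((diag E x + diag E y) / 2) ^ 2 < k ^ 2) by nra.
      assert (H0 := pow2_ge_0 (diag E x - diag E y)). nra. }
  set (SX := lsum (diag E) (selectP X K)).
  assert (H1 : lsum (fun x => lsum (fun y => ind (X x) * Cmod (kern E x y) ^ 2) K) K <= SX).
  { unfold SX. rewrite lsum_selectP. apply lsum_le; intros x Hx.
    rewrite lsum_scal. apply Rmult_le_compat_l; [apply ind_bounds|].
    now apply ON_kern_row_le. }
  assert (H2 : lsum (fun x => lsum (fun y => ind (X y) * Cmod (kern E x y) ^ 2) K) K <= SX).
  { rewrite lsum_swap. eapply Rle_trans; [|exact H1]. apply Req_le.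
    apply lsum_ext; intros x _. apply lsum_ext; intros y _. now rewrite Cmod_kern_sym. }
  assert (H3 : lsum (fun x => lsum (fun y => t x y * (diag E x / 2)) K) K <= r / 8).
  { apply Rle_trans with (lsum (fun x => 1 / 8 * diag E x) K).
    - apply lsum_le; intros x Hx.
      rewrite (lsum_ext _ (fun y => diag E x / 2 * t x y)) by (intros; ring).
      rewrite lsum_scal. specialize (Htsum x Hx). assert (Hq := diag_nonneg E x). nra.
    - rewrite lsum_scal; lra. }
  assert (H4 : lsum (fun x => lsum (fun y => t x y * (diag E y / 2)) K) K <= r / 8).
  { rewrite lsum_swap. eapply Rle_trans; [|exact H3]. apply Req_le.
    apply lsum_ext; intros x _. apply lsum_ext; intros y _. now rewrite Htsym. }
  assert (H5 : W <= (SX + SX) + (r / 8 + r / 8)).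
  { eapply Rle_trans.
    - unfold W. apply lsum_le; intros x _. apply lsum_le; intros y _. apply Hpt.
    - rewrite (lsum_ext _ (fun x =>
        (lsum (fun y => ind (X x) * Cmod (kern E x y) ^ 2) K +
         lsum (fun y => ind (X y) * Cmod (kern E x y) ^ 2) K) +
        (lsum (fun y => t x y * (diag E x / 2)) K + lsum (fun y => t x y * (diag E y / 2)) K)))
        by (intros; now rewrite !lsum_plus).
      rewrite !lsum_plus. lra. }
  fold SX. lra.
Qed.

(** Outside [K l] the eigenfunctions of label [l] are small, so their mass sits in the cluster.
    Inside it, their kernel differs from the full one only by eigenfunctions of other labels, which
    are small there, so it inherits the decay of [P] up to a tiny error. *)
Lemma class_concentrated {d} (E : list (vec d)) (lf : vec d -> nat) (a : Zd d -> nat)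
  (K : nat -> list (Zd d)) (c L S0 eps kappa R0 V eta0 : R) (l : nat) :
  0 < c -> 0 <= R0 -> 0 <= eps -> exp_summable d (c / 8) S0 -> ON E -> (1 <= l)%nat ->
  (forall x y, Cmod (kern E x y) <= exp (L - c * linf_dist x y)) ->
  (forall f, In f E -> (1 <= lf f)%nat) ->
  (forall f y, In f E -> a y <> lf f -> Cmod (f y) <= eps * Phi c (K (lf f)) y) ->
  (forall k, NoDup (K k)) ->
  (forall k x, (1 <= k)%nat -> In x (K k) <-> a x = k) ->
  (forall k, INR (length (K k)) <= kappa) ->
  0 < V -> (2 * R0 + 3) ^ d <= V -> eta0 = 1 / (16 * V) ->
  INR (length E) * eps ^ 2 * kappa ^ 2 * S0 <= 1 / 8 ->
  S0 * exp (L - 7 * c / 8 * R0) + kappa * (INR (length E) * (eps * kappa) ^ 2) <= 1 / 8 ->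
  (1 <= length (selectP (fun f => lf f = l) E))%nat ->
  INR (length (selectP (fun f => lf f = l) E)) / 4 <=
  lsum (diag (selectP (fun f => lf f = l) E))
    (selectP (fun x => 2 * eta0 <= diag (selectP (fun f => lf f = l) E) x) (K l)).
Proof.
  intros Hc HR0 Heps HS HON Hl Hdec Hlf Hoff HKnd HK Hkappa HV HVd Heta Hsm1 Hsm2 Hlen.
  set (Sl := selectP (fun f => lf f = l) E) in *.
  (* This is the summability bound for the empty list at some site; a normalized vector guarantees
     that a site exists. *)
  assert (HS0 : 0 <= S0).
  { destruct Sl as [|f Sl'] eqn:ESl; [simpl in Hlen; lia|].
    assert (In f E) as HfE.
    { assert (In f Sl) by (rewrite ESl; now left). now apply in_selectP in H. }
    destruct (classic (exists z : Zd d, True)) as [[z _]|Hno].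
    - apply (HS z nil (NoDup_nil _)).
    - exfalso. assert (H1 : 1 <= 0); [|lra].
      apply (HasSum_real_le _ _ _ (ip_self_real f (ON_in E f HON HfE))). intros [|x F] _.
      + unfold lsum; simpl; lra.
      + exfalso; apply Hno; now exists x. }
  assert (Hk0 : 0 <= kappa) by (eapply Rle_trans; [apply pos_INR|apply (Hkappa l)]).
  assert (HONl : ON Sl) by now apply ON_selectP.
  apply (concentrated_mass Sl (K l) (fun x y => linf_dist x y <= R0) V eta0); auto.
  - intros x y H; now rewrite dist_sym.
  - intros G HG HGK. unfold diag. rewrite lsum_swap.
    apply Rle_trans with (lsum (fun f : vec d => eps ^ 2 * kappa ^ 2 * S0) Sl).
    + apply lsum_le; intros f Hf. apply in_selectP in Hf; destruct Hf as [Hf Hfl].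
      apply Rle_trans with (lsum (fun y => (eps ^ 2 * kappa) * Phi c (K l) y) G).
      * apply lsum_le; intros y Hy.
        assert (H1 : a y <> lf f).
        { rewrite Hfl. intros H1; apply (HGK y Hy). now apply HK. }
        assert (H2 := Hoff f y Hf H1). rewrite Hfl in H2.
        assert (H3 := Phi_nonneg c (K l) y).
        assert (H4 : Phi c (K l) y <= kappa).
        { eapply Rle_trans; [now apply Phi_le_length|apply Hkappa]. }
        apply Rle_trans with ((eps * Phi c (K l) y) ^ 2).
        -- apply pow_incr; split; [apply Cmod_ge_0|exact H2].
        -- replace ((eps * Phi c (K l) y) ^ 2) with (eps ^ 2 * Phi c (K l) y * Phi c (K l) y) by ring.
           apply Rmult_le_compat_r; auto. apply Rmult_le_compat_l; auto using pow2_ge_0.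
      * rewrite lsum_scal.
        replace (eps ^ 2 * kappa ^ 2 * S0) with (eps ^ 2 * kappa * (kappa * S0)) by ring.
        apply Rmult_le_compat_l.
        -- apply Rmult_le_pos; auto using pow2_ge_0.
        -- eapply Rle_trans; [now apply (Phi_sum c S0)|]. now apply Rmult_le_compat_r.
    + rewrite lsum_const.
      eapply Rle_trans; [|exact Hsm1].
      assert (H1 : INR (length Sl) <= INR (length E)).
      { apply le_INR. unfold Sl, selectP. apply filter_length_le. }
      rewrite !Rmult_assoc. apply Rmult_le_compat_r; auto.
      apply Rmult_le_pos; [apply pow2_ge_0|]. apply Rmult_le_pos; auto using pow2_ge_0.
  - intros x Hx. set (G := selectP (fun y => ~ linf_dist x y <= R0) (K l)).
    assert (HG : NoDup G) by now apply NoDup_selectP.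
    assert (Hpt : forall y, In y G -> Cmod (kern Sl x y) <=
      exp L * exp (- (c * linf_dist y x)) + INR (length E) * (eps * kappa) ^ 2).
    { intros y Hy. apply in_selectP in Hy; destruct Hy as [Hy _].
      set (Sc := selectP (fun f => ~ lf f = l) E).
      assert (Hk : kern E x y = Cplus (kern Sl x y) (kern Sc x y)).
      { rewrite <- kern_app. apply kern_perm, selectP_split. }
      replace (kern Sl x y) with (Cplus (kern E x y) (Copp (kern Sc x y))) by (rewrite Hk; ring).
      eapply Rle_trans; [apply Cmod_triangle|]. rewrite Cmod_opp.
      apply Rplus_le_compat.
      - rewrite <- exp_plus. rewrite (dist_sym y x). apply Hdec.
      - eapply Rle_trans; [apply Cmod_csum_le|].
        apply Rle_trans with (lsum (fun _ : vec d => (eps * kappa) ^ 2) Sc).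
        + apply lsum_le; intros f Hf. apply in_selectP in Hf; destruct Hf as [Hf Hfl].
          assert (Hb : forall z, In z (K l) -> Cmod (f z) <= eps * kappa).
          { intros z Hz. apply HK in Hz; auto.
            eapply Rle_trans; [apply Hoff; auto; congruence|].
            apply Rmult_le_compat_l; auto.
            eapply Rle_trans; [now apply Phi_le_length|apply Hkappa]. }
          rewrite Cmod_mult, Cmod_conj.
          replace ((eps * kappa) ^ 2) with ((eps * kappa) * (eps * kappa)) by ring.
          apply Rmult_le_compat; auto using Cmod_ge_0.
        + rewrite lsum_const. apply Rmult_le_compat_r; [apply pow2_ge_0|].
          apply le_INR. unfold Sc, selectP. apply filter_length_le. }
    eapply Rle_trans; [apply lsum_le, Hpt|].
    rewrite lsum_plus, lsum_scal, lsum_const.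
    eapply Rle_trans; [|exact Hsm2]. apply Rplus_le_compat.
    + assert (H1 := lsum_exp_tail (c / 8) c S0 R0 x G HS ltac:(lra) HG).
      replace (exp (L - 7 * c / 8 * R0)) with (exp L * exp (- ((c - c / 8) * R0)))
        by (rewrite <- exp_plus; f_equal; field).
      rewrite (Rmult_comm S0), Rmult_assoc, (Rmult_comm _ S0).
      apply Rmult_le_compat_l; [left; apply exp_pos|]. apply H1.
      intros y Hy. apply in_selectP in Hy; destruct Hy as [_ Hy].
      rewrite dist_sym. apply Rnot_le_lt in Hy; lra.
    + apply Rmult_le_compat_r.
      * apply Rmult_le_pos; auto using pos_INR, pow2_ge_0.
      * eapply Rle_trans; [|apply (Hkappa l)].
        apply le_INR. unfold G, selectP. apply filter_length_le.
  - intros x _. eapply Rle_trans; [|exact HVd].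
    apply (ball_volume x); auto; [now apply NoDup_selectP|].
    intros y Hy. apply in_selectP in Hy. now rewrite dist_sym.
Qed.

Lemma selectP_comp {T} (Q Q' : T -> Prop) (l : list T) :
  (forall x, Q x -> Q' x) -> selectP Q (selectP Q' l) = selectP Q l.
Proof.
  intros H; induction l as [|x l IH]; [reflexivity|].
  unfold selectP in *; simpl.
  destruct (excluded_middle_informative (Q' x)) as [H1|H1]; simpl;
    destruct (excluded_middle_informative (Q x)) as [H2|H2]; rewrite ?IH; auto.
  exfalso; auto.
Qed.

Lemma partition_by_label {T} (lf : T -> nat) (ls : list nat) : NoDup ls ->
  forall E : list T, (forall f, In f E -> In (lf f) ls) ->
  Permutation E (concat (map (fun l => selectP (fun f => lf f = l) E) ls)).
Proof.
  induction 1 as [|l ls Hl Hls IH]; intros E HE.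
  - destruct E as [|f E]; [constructor|]. destruct (HE f (or_introl eq_refl)).
  - simpl. etransitivity; [apply (selectP_split (fun f => lf f = l))|].
    apply Permutation_app_head. etransitivity; [apply IH|].
    + intros f Hf. apply in_selectP in Hf; destruct Hf as [Hf Hfl].
      destruct (HE f Hf); [congruence|auto].
    + apply Permutation_refl'. f_equal. apply map_ext_in; intros k Hk.
      apply selectP_comp. intros f Hf; congruence.
Qed.

(** Each class is rotated within itself, the others being spectators in [Rst]. A new vector is thus
    dominated pointwise by the diagonal of its class, which is how it inherits the decay. *)
Lemma rotate_classes {T} (eta0 : R) : 0 < eta0 ->
  forall (Es : list (list (T -> C))) Rst, ON (concat Es ++ Rst) ->
  (forall E, In E Es -> exists X, NoDup X /\ (forall x, In x X -> 2 * eta0 <= diag E x) /\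
     INR (length E) / 4 <= lsum (diag E) X) ->
  exists E', ON (E' ++ Rst) /\ length E' = length (concat Es) /\
    (forall x y, kern E' x y = kern (concat Es) x y) /\
    (forall f, In f E' -> (exists x, eta0 / 16 <= Cmod (f x) ^ 2) /\
       exists E, In E Es /\ forall y, Cmod (f y) ^ 2 <= diag E y).
Proof.
  intros Heta; induction Es as [|E Es IH]; intros Rst HON HX.
  - exists nil. split; [exact HON|]. split; [reflexivity|]. split; [reflexivity|]. simpl; tauto.
  - simpl concat in *. rewrite <- app_assoc in HON.
    destruct (HX E (or_introl eq_refl)) as [X [HX1 [HX2 HX3]]].
    destruct (peaked_family X eta0 E (concat Es ++ Rst) Heta HX1 HON HX2 HX3)
      as [E1 [H1 [H2 [H3 H4]]]].
    destruct (IH (E1 ++ Rst)) as [E2 [G1 [G2 [G3 G4]]]].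
    + eapply ON_perm; [|exact H1]. apply Permutation_app_swap_app.
    + intros F HF; apply HX; now right.
    + exists (E1 ++ E2). split; [|split; [|split]].
      * eapply ON_perm; [|exact G1]. rewrite <- app_assoc. apply Permutation_app_swap_app.
      * rewrite !length_app; congruence.
      * intros x y. now rewrite !kern_app, H3, G3.
      * intros f Hf. apply in_app_iff in Hf; destruct Hf as [Hf|Hf].
        -- split; [now apply H4|]. exists E; split; [now left|].
           intros y. rewrite <- (diag_of_kern _ _ H3 y). now apply diag_ge.
        -- destruct (G4 f Hf) as [G5 [F [HF HF']]]. split; auto.
           exists F; split; [now right|auto].
Qed.

(** * Diagonalization *)

Module Diagonalization.
Import all_boot all_order all_algebra Rstruct complex.
Import GRing.Theory Num.Theory.
Local Open Scope ring_scope.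
Local Open Scope complex_scope.
Local Open Scope sesquilinear_scope.

Definition toC (z : Complex.C) : R[i] := Complex z.1 z.2.
Definition ofC (z : R[i]) : Complex.C := (complex.Re z, complex.Im z).

Lemma ofCK z : toC (ofC z) = z. Proof. by case: z. Qed.

Lemma toC_inj : injective toC.
Proof. by case=> a b [c d] [-> ->]. Qed.

Lemma toCD z w : toC (Cplus z w) = toC z + toC w. Proof. by []. Qed.
Lemma toCM z w : toC (Cmult z w) = toC z * toC w. Proof. by []. Qed.
Lemma toC_conj z : toC (Cconj z) = Num.conj (toC z). Proof. by []. Qed.
Lemma toC0 : toC (RtoC (IZR Z0)) = 0. Proof. by []. Qed.

Lemma toC_sum m (f : nat -> Complex.C) :
  toC (csum f (List.seq 0 m)) = \sum_(i < m) toC (f i).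
Proof.
elim: m => [|m IH]; first by rewrite big_ord0.
by rewrite List.seq_S csum_app toCD IH big_ord_recr /= toCD toC0 addr0.
Qed.

(** The spectral theorem for normal matrices, carried over from matrices over [R[i]] to arrays of
    Coquelicot complex numbers indexed by naturals. The eigenvectors are the columns of [U]. *)
Lemma unitary_diagonalization (m : nat) (A : nat -> nat -> Complex.C) :
  (forall j k, A k j = Cconj (A j k)) ->
  exists (U : nat -> nat -> Complex.C) (lam : nat -> Complex.C),
    (forall i j, (i < m)%coq_nat -> (j < m)%coq_nat ->
      csum (fun k => Cmult (Cconj (U k i)) (U k j)) (List.seq 0 m)
      = if Nat.eqb i j then RtoC (IZR (Zpos xH)) else RtoC (IZR Z0)) /\
    (forall i j, (i < m)%coq_nat -> (j < m)%coq_nat ->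
      csum (fun k => Cmult (U i k) (Cconj (U j k))) (List.seq 0 m)
      = if Nat.eqb i j then RtoC (IZR (Zpos xH)) else RtoC (IZR Z0)) /\
    (forall i j, (i < m)%coq_nat -> (j < m)%coq_nat ->
      csum (fun k => Cmult (A j k) (U k i)) (List.seq 0 m) = Cmult (lam i) (U j i)).
Proof.
case: m => [|m] HA.
  (* Size zero is separate because [inord] needs a nonempty index type. *)
  exists (fun _ _ => RtoC (IZR Z0)), (fun _ => RtoC (IZR Z0)).
  by split; [|split] => i j /ltP.
pose M : 'M[R[i]]_m.+1 := \matrix_(i, j) toC (A i j).
pose P := spectralmx M; pose sp := spectral_diag M.
have HP : P *m P ^t* = 1%:M by apply/unitarymxP/spectral_unitarymx.
have HP' : P ^t* *m P = 1%:M by apply: mulmx1C.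
have Mherm : M ^t* = M.
  by apply/matrixP=> i j; rewrite !mxE -toC_conj -HA.
have /orthomx_spectralP Mn : M \is normalmx.
  by apply/normalmxP; rewrite Mherm.
have HM : M *m P ^t* = P ^t* *m diag_mx sp.
  rewrite {1}Mn -/P -/sp invmx_unitary ?spectral_unitarymx //.
  by rewrite -!mulmxA HP mulmx1.
(* [U] is the conjugate transpose of the spectral matrix, whose columns are eigenvectors by [HM]. *)
pose U (i j : nat) := ofC (Num.conj (P (inord j) (inord i))).
exists U, (fun i => ofC (sp 0 (inord i))).
have eqd (i j : nat) : (i < m.+1)%N -> (j < m.+1)%N ->
  toC (if Nat.eqb i j then RtoC (IZR (Zpos xH)) else RtoC (IZR Z0)) = (inord i == inord j :> 'I_m.+1)%:R.
  move=> hi hj; case: Nat.eqb_spec => [->|/eqP ne]; first by rewrite eqxx.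
  by rewrite -val_eqE /= !inordK // (negbTE ne).
split; [|split] => i j /ltP hi /ltP hj; apply: toC_inj; rewrite toC_sum.
- rewrite eqd //.
  move/matrixP/(_ (inord i) (inord j)): HP; rewrite !mxE => <-.
  apply: eq_bigr => k _; rewrite toCM toC_conj !ofCK conjCK !mxE.
  by rewrite inord_val.
- rewrite eqd //.
  move/matrixP/(_ (inord i) (inord j)): HP'; rewrite !mxE => <-.
  apply: eq_bigr => k _; rewrite toCM toC_conj !ofCK conjCK !mxE.
  by rewrite inord_val.
- move/matrixP/(_ (inord j) (inord i)): HM; rewrite mul_mx_diag !mxE => H.
  rewrite toCM !ofCK mulrC -H.
  apply: eq_bigr => k _; rewrite toCM !ofCK !mxE.
  by rewrite inord_val inordK.
Qed.
End Diagonalization.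

Lemma csum_delta (g : nat -> C) m k : (k < m)%nat ->
  csum (fun l => Cmult (g l) (if Nat.eqb k l then RtoC 1 else RtoC 0)) (seq 0 m) = g k.
Proof.
  induction m as [|m IH]; intros Hk; [lia|].
  rewrite seq_S, csum_app. simpl (0 + m)%nat. unfold csum at 2; simpl.
  destruct (Nat.eq_dec k m) as [->|Hne].
  - rewrite Nat.eqb_refl, csum_zero; [ring|].
    intros l Hl; apply in_seq in Hl. destruct (Nat.eqb_spec m l); [lia|ring].
  - rewrite IH by lia. destruct (Nat.eqb_spec k m); [lia|ring].
Qed.

Lemma ON_map {T} (psi : nat -> T -> C) (ls : list nat) : NoDup ls ->
  (forall i j, In i ls -> In j ls ->
    ip (psi i) (psi j) (if Nat.eqb i j then RtoC 1 else RtoC 0)) ->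
  ON (map psi ls).
Proof.
  induction 1 as [|i ls Hi Hls IH]; intros H; simpl; [exact I|].
  split; [|split].
  - assert (Hii := H i i (or_introl eq_refl) (or_introl eq_refl)).
    now rewrite Nat.eqb_refl in Hii.
  - intros g Hg; apply in_map_iff in Hg; destruct Hg as [j [<- Hj]].
    assert (Hij := H i j (or_introl eq_refl) (or_intror Hj)).
    destruct (Nat.eqb_spec i j); [congruence|exact Hij].
  - apply IH; intros; apply H; now right.
Qed.

Lemma ON_nth {T} (E : list (T -> C)) g : ON E ->
  forall i j, (i < length E)%nat -> (j < length E)%nat ->
  ip (nth i E g) (nth j E g) (if Nat.eqb i j then RtoC 1 else RtoC 0).
Proof.
  induction E as [|f E IH]; simpl; [lia|].
  intros [H1 [H2 H3]] [|i] [|j] Hi Hj; simpl; auto.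
  - apply H2, nth_In; lia.
  - apply ip_sym0, H2, nth_In; lia.
  - apply IH; auto; lia.
Qed.

Lemma map_nth_all {T} (E : list T) g :
  map (fun k => nth k E g) (seq 0 (length E)) = E.
Proof.
  induction E as [|f E IH]; [reflexivity|].
  simpl. f_equal. rewrite <- seq_shift, map_map. exact IH.
Qed.

(** Since [a] has finite support, its compression to the range is the Hermitian matrix with entries
    [<phi_j, a phi_k>], each a finite sum. Unitary recombination of [phi] keeps the kernel and turns
    matrix eigenvectors into solutions of [P a f = lam f]. *)
Lemma eigenbasis {d} (m : nat) (phi : nat -> vec d) (a : Zd d -> nat) (H : list (Zd d)) :
  orthonormal m phi -> NoDup H -> (forall x, a x <> 0%nat -> In x H) ->
  exists E : list (vec d), ON E /\ length E = m /\
    (forall x y, kern E x y = proj_kernel m phi x y) /\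
    (forall f, In f E -> exists lam, forall y,
      HasSum (fun x => Cmult (Cmult (RtoC (INR (a x))) (kern E y x)) (f x))
             (Cmult lam (f y))).
Proof.
  intros Hphi HH Ha.
  set (A := fun j k => csum (fun x => Cmult (RtoC (INR (a x)))
    (Cmult (Cconj (phi j x)) (phi k x))) H).
  destruct (Diagonalization.unitary_diagonalization m A) as [U [lam [U1 [U2 U3]]]].
  { intros j k. unfold A. rewrite <- csum_conj. apply csum_ext; intros x _.
    rewrite !Cmult_conj, Cconj_conj, Cconj_RtoC; ring. }
  set (psi := fun (i : nat) (x : Zd d) => csum (fun k => Cmult (U k i) (phi k x)) (seq 0 m)).
  assert (Hseq : forall k, In k (seq 0 m) -> (k < m)%nat) by (intros k Hk; apply in_seq in Hk; lia).
  assert (Hkern : forall x y, kern (map psi (seq 0 m)) x y = proj_kernel m phi x y).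
  { intros x y. unfold kern, csum. rewrite map_map.
    fold (csum (fun i => Cmult (psi i x) (Cconj (psi i y))) (seq 0 m)).
    unfold proj_kernel. fold (csum (fun k => Cmult (phi k x) (Cconj (phi k y))) (seq 0 m)).
    transitivity (csum (fun i => csum (fun k => csum (fun l =>
      Cmult (Cmult (phi k x) (Cconj (phi l y))) (Cmult (U k i) (Cconj (U l i))))
      (seq 0 m)) (seq 0 m)) (seq 0 m)).
    - apply csum_ext; intros i _. unfold psi at 1. rewrite Cmult_comm, <- csum_scal.
      apply csum_ext; intros k _. unfold psi. rewrite <- csum_conj.
      rewrite Cmult_comm, <- csum_scal. apply csum_ext; intros l _.
      rewrite Cmult_conj; ring.
    - rewrite csum_swap. apply csum_ext; intros k Hk. rewrite csum_swap.
      rewrite <- (csum_delta (fun l => Cmult (phi k x) (Cconj (phi l y))) m k) by auto.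
      apply csum_ext; intros l Hl. rewrite csum_scal, U2 by auto. reflexivity. }
  exists (map psi (seq 0 m)). split; [|split; [|split]].
  - apply ON_map; [apply seq_NoDup|]. intros i j Hi Hj.
    apply HasSum_eq with (csum (fun k => csum (fun l =>
      Cmult (Cmult (Cconj (U k i)) (U l j)) (if Nat.eqb k l then RtoC 1 else RtoC 0))
      (seq 0 m)) (seq 0 m)).
    + apply (HasSum_ext (fun x => csum (fun k => csum (fun l =>
        Cmult (Cmult (Cconj (U k i)) (U l j)) (Cmult (Cconj (phi k x)) (phi l x)))
        (seq 0 m)) (seq 0 m))).
      * intros x. unfold psi at 1. rewrite <- csum_conj.
        rewrite Cmult_comm, <- csum_scal. apply csum_ext; intros k _.
        unfold psi. rewrite Cmult_comm, <- csum_scal. apply csum_ext; intros l _.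
        rewrite Cmult_conj; ring.
      * apply (HasSum_csum (fun k x => csum (fun l =>
          Cmult (Cmult (Cconj (U k i)) (U l j)) (Cmult (Cconj (phi k x)) (phi l x)))
          (seq 0 m))). intros k Hk.
        apply (HasSum_csum (fun l x =>
          Cmult (Cmult (Cconj (U k i)) (U l j)) (Cmult (Cconj (phi k x)) (phi l x)))).
        intros l Hl. apply HasSum_scal, Hphi; auto.
    + rewrite <- (U1 i j) by auto. apply csum_ext; intros k Hk.
      apply (csum_delta (fun l => Cmult (Cconj (U k i)) (U l j))); auto.
  - now rewrite length_map, length_seq.
  - exact Hkern.
  - intros f Hf. apply in_map_iff in Hf; destruct Hf as [i [<- Hi]]. apply Hseq in Hi.
    exists (lam i); intros y.
    eapply HasSum_eq; [apply (HasSum_finite _ H HH)|].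
    + intros x Hx. assert (a x = 0%nat) as ->.
      { apply NNPP; intros Hn; apply Hx, Ha, Hn. }
      simpl. ring.
    + transitivity (csum (fun x => csum (fun j => csum (fun k =>
        Cmult (Cmult (phi j y) (U k i)) (Cmult (RtoC (INR (a x)))
          (Cmult (Cconj (phi j x)) (phi k x)))) (seq 0 m)) (seq 0 m)) H).
      * apply csum_ext; intros x _. rewrite Hkern.
        unfold proj_kernel. fold (csum (fun k => Cmult (phi k y) (Cconj (phi k x))) (seq 0 m)).
        transitivity (Cmult (Cmult (RtoC (INR (a x))) (psi i x))
          (csum (fun k => Cmult (phi k y) (Cconj (phi k x))) (seq 0 m))); [ring|].
        rewrite <- csum_scal. apply csum_ext; intros j _.
        transitivity (Cmult (Cmult (RtoC (INR (a x))) (Cmult (phi j y) (Cconj (phi j x))))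
          (psi i x)); [ring|].
        unfold psi. rewrite <- csum_scal. apply csum_ext; intros k _. ring.
      * rewrite csum_swap. unfold psi. rewrite <- csum_scal.
        apply csum_ext; intros j Hj. rewrite csum_swap.
        transitivity (Cmult (phi j y) (csum (fun k => Cmult (A j k) (U k i)) (seq 0 m))).
        -- rewrite <- csum_scal. apply csum_ext; intros k _. rewrite csum_scal.
           unfold A; ring.
        -- rewrite U3 by auto; ring.
Qed.

(** * The localized basis *)

(** The successor reserves the value 0 for sites far from the net; if several net points are close,
    the first one in [Y] decides. *)
Definition site_label {d} (Y : list (Zd d)) (lab : Zd d -> nat) (r : R) (x : Zd d) : nat :=
  match find (fun y => if Rle_dec (linf_dist x y) r then true else false) Y with
  | Some y => S (lab y)
  | None => 0%nat
  end.

Lemma site_label_zero {d} (Y : list (Zd d)) lab r x :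
  site_label Y lab r x = 0%nat <-> (forall y, In y Y -> r < linf_dist x y).
Proof.
  unfold site_label. destruct (find _ Y) as [y|] eqn:Ef.
  - apply find_some in Ef; destruct Ef as [Hy Hd].
    destruct (Rle_dec (linf_dist x y) r); [|discriminate].
    split; [discriminate|]. intros H; specialize (H y Hy); lra.
  - split; auto. intros _ y Hy. assert (H := find_none _ _ Ef y Hy). simpl in H.
    destruct (Rle_dec (linf_dist x y) r); [discriminate|lra].
Qed.

Lemma site_label_pos {d} (Y : list (Zd d)) lab r x :
  site_label Y lab r x <> 0%nat ->
  exists y, In y Y /\ linf_dist x y <= r /\ site_label Y lab r x = S (lab y).
Proof.
  unfold site_label. destruct (find _ Y) as [y|] eqn:Ef; [|congruence].
  apply find_some in Ef; destruct Ef as [Hy Hd].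
  destruct (Rle_dec (linf_dist x y) r); [|discriminate]. eauto.
Qed.

Lemma le_of_sq (a b : R) : 0 <= b -> a ^ 2 <= b ^ 2 -> a <= b.
Proof. intros Hb H. apply Rnot_lt_le; intros Hlt. nra. Qed.

Lemma exp_sq (a : R) : exp a ^ 2 = exp (2 * a).
Proof. replace (2 * a) with (a + a) by ring. rewrite exp_plus; ring. Qed.

(** Sites of label 0 see no heavy site within [50 L / c], so their diagonal is tiny; sites with
    distinct nonzero labels are far apart, so [P] decays between them. Both cases reach the same
    coupling bound. *)
Lemma label_geometry {d} (E : list (vec d)) (c L S0 : R) :
  0 < c -> 0 < L -> 1 <= S0 -> exp_summable d (c / 8) S0 -> ON E ->
  (forall x y, Cmod (kern E x y) <= exp (L - c * linf_dist x y)) ->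
  100 * S0 <= exp L ->
  S0 * exp (- (2 * L)) <= / (4 * (2 * (50 * L / c) + 3) ^ d) ->
  exists (a : Zd d -> nat) (N : nat) (H : list (Zd d)),
    INR N <= 2 * INR (length E) /\ (forall x, (a x <= N)%nat) /\
    NoDup H /\ (forall x, In x H <-> a x <> 0%nat) /\
    INR (length H) <= 2 * INR (length E) * (2 * (58 * L / c) + 3) ^ d /\
    (forall x y, a x <> a y ->
      Cmod (kern E x y) <= exp (- (11 * L)) * exp (- (c / 2 * linf_dist x y))) /\
    (forall x y, a y = 0%nat ->
      Cmod (kern E x y) <= exp (- (11 * L)) * exp (- (c / 2 * linf_dist x y))) /\
    (forall x z, a x <> 0%nat -> a x = a z ->
      linf_dist x z <= 2 * (58 * L / c) + 140 * L / c * (2 * INR (length E))).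
Proof.
  intros Hc HL HS1 HS HON Hdec HSL Hsm.
  (* [R0] turns the tail [exp(2 L - c R0)] into [exp(- 2 L)], which secures mass 1/2 near heavy
     sites; [R1] makes it [exp(- 48 L)] at light ones; and [R2 = R1 + 2 R0], because the net reaches
     every heavy site within [2 R0]. *)
  set (R0 := 4 * L / c). set (R1 := 50 * L / c) in *. set (R2 := 58 * L / c).
  set (V1 := (2 * R1 + 3) ^ d) in *.
  assert (HLc : 0 < L / c) by now apply Rdiv_lt_0_compat.
  assert (ER0 : R0 = 4 * (L / c)) by (unfold R0; field; lra).
  assert (ER1 : R1 = 50 * (L / c)) by (unfold R1; field; lra).
  assert (ER2 : R2 = 58 * (L / c)) by (unfold R2; field; lra).
  assert (ELc : c * (L / c) = L) by (field; lra).
  assert (HV1 : 0 < V1) by (apply pow_lt; lra).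
  set (eta1 := / (2 * V1)).
  assert (Heta1 : 0 < eta1) by (apply Rinv_0_lt_compat; lra).
  assert (Hsm' : S0 * exp (- (2 * L)) <= eta1 / 2).
  { replace (eta1 / 2) with (/ (4 * V1)) by (unfold eta1; field; lra). exact Hsm. }
  assert (HR0 : 0 <= R0) by lra. assert (HR1 : 0 <= R1) by lra. assert (HR2 : 0 <= R2) by lra.
  set (m := INR (length E)).
  assert (Hheavy : forall x, eta1 <= diag E x -> 1 / 2 <= lsum (diag E) (ball R0 HR0 x)).
  { intros x Hx.
    assert (H := diag_le_ball_mass E c L S0 R0 x (ball R0 HR0 x) Hc HON HS Hdec
      (ball_NoDup _ _ _) (fun y Hy => proj2 (in_ball R0 HR0 x y) Hy) HR0).
    replace (2 * L - c * R0) with (- (2 * L)) in H by (rewrite ER0; lra). nra. }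
  assert (Hlight : forall x, (forall y, linf_dist y x <= R1 -> diag E y < eta1) ->
    diag E x <= exp (- (47 * L))).
  { intros x Hx.
    assert (H := diag_le_ball_mass E c L S0 R1 x (ball R1 HR1 x) Hc HON HS Hdec
      (ball_NoDup _ _ _) (fun y Hy => proj2 (in_ball R1 HR1 x y) Hy) HR1).
    replace (2 * L - c * R1) with (L * (-1) + - (47 * L)) in H by (rewrite ER1; lra).
    assert (Hb : lsum (diag E) (ball R1 HR1 x) <= 1 / 2).
    { apply Rle_trans with (lsum (fun _ => eta1) (ball R1 HR1 x)).
      - apply lsum_le; intros y Hy. left; apply Hx. now apply in_ball in Hy.
      - rewrite lsum_const. apply Rle_trans with (V1 * eta1).
        + apply Rmult_le_compat_r; [lra|]. apply length_ball.
        + unfold eta1. apply Req_le; field; lra. }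
    rewrite exp_plus in H. assert (Hd := diag_nonneg E x).
    assert (He : 2 * (S0 * exp (L * (-1))) <= 1).
    { replace (L * -1) with (- L) by ring. rewrite exp_Ropp.
      assert (0 < exp L) by apply exp_pos.
      assert (S0 * / exp L <= 1 / 2); [|lra]. apply Rle_div_l; lra. }
    assert (H47 := exp_pos (- (47 * L))). nra. }
  destruct (separated_net (fun x => eta1 <= diag E x) (diag E) R0 m HR0
    (diag_nonneg E) (fun F HF => ON_diag_sum_le E F HON HF) Hheavy) as [Y [HY1 [HY2 [HY3 HY4]]]].
  set (s := 140 * L / c).
  assert (Es : s = 140 * (L / c)) by (unfold s; field; lra).
  destruct (clustering linf_dist s ltac:(lra) dist_self dist_sym dist_triangle Y HY1)
    as [lab [L1 [L2 L3]]].
  set (a := site_label Y lab R2).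
  set (H := nodup (eq_dec_classic _) (flat_map (ball R2 HR2) Y)).
  assert (HinH : forall x, In x H <-> a x <> 0%nat).
  { intros x. unfold H. rewrite nodup_In, in_flat_map. split.
    - intros [y [Hy Hx]] H0. apply in_ball in Hx.
      assert (R2 < linf_dist x y); [|lra].
      now apply (proj1 (site_label_zero Y lab R2 x) H0).
    - intros H0. destruct (site_label_pos Y lab R2 x H0) as [y [Hy [Hd _]]].
      exists y; split; auto. now apply in_ball. }
  assert (Hl : forall x y, a y = 0%nat ->
      Cmod (kern E x y) <= exp (- (11 * L)) * exp (- (c / 2 * linf_dist x y))).
  { intros x y Hy.
    assert (Hp : diag E y <= exp (- (47 * L))).
    { apply Hlight; intros z Hz. apply Rnot_le_lt; intros Hh.
      destruct (HY4 z Hh) as [w [Hw1 Hw2]].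
      assert (H0 := proj1 (site_label_zero Y lab R2 y) Hy w Hw1).
      assert (H1 := dist_triangle y z w). rewrite (dist_sym y z) in H1. lra. }
    set (k := Cmod (kern E x y)).
    assert (Hk0 : 0 <= k) by apply Cmod_ge_0.
    assert (Hk1 : k ^ 2 <= exp (- (47 * L))).
    { eapply Rle_trans; [apply kern_cauchy_schwarz|].
      assert (H1 := ON_diag_le_1 E x HON). assert (H2 := diag_nonneg E x).
      assert (H3 := diag_nonneg E y). nra. }
    assert (Hk2 : k <= exp (- (47 / 2 * L))).
    { apply le_of_sq; [left; apply exp_pos|]. rewrite exp_sq.
      replace (2 * - (47 / 2 * L)) with (- (47 * L)) by field. exact Hk1. }
    (* The geometric mean of the uniform smallness [exp(- 47/2 L)] and the decay
       [exp(L - c |x - y|)] gives both factors at once. *)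
    rewrite <- exp_plus. apply le_of_sq; [left; apply exp_pos|]. rewrite exp_sq.
    apply Rle_trans with (exp (- (47 / 2 * L)) * exp (L - c * linf_dist x y)).
    - replace (k ^ 2) with (k * k) by ring. apply Rmult_le_compat; auto. apply Hdec.
    - rewrite <- exp_plus. apply exp_le_mono. nra. }
  exists a, (length Y), H. split; [|split; [|split; [|split; [|split; [|split; [|split]]]]]]; auto.
  - intros x. destruct (Nat.eq_dec (a x) 0) as [E0|E0]; [lia|].
    destruct (site_label_pos Y lab R2 x E0) as [y [Hy [_ Hly]]].
    unfold a. rewrite Hly. now apply L1.
  - apply NoDup_nodup.
  - apply Rle_trans with (INR (length (flat_map (ball R2 HR2) Y))).
    + apply le_INR. apply NoDup_incl_length; [apply NoDup_nodup|].
      intros x; apply nodup_In.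
    + rewrite <- (Rmult_1_r (INR _)), <- lsum_const, lsum_flat_map.
      apply Rle_trans with (lsum (fun _ => (2 * R2 + 3) ^ d) Y).
      * apply lsum_le; intros y _. rewrite lsum_const, Rmult_1_r. apply length_ball.
      * rewrite lsum_const. apply Rmult_le_compat_r; [|exact HY3]. apply pow_le; lra.
  - intros x y Hxy.
    destruct (Nat.eq_dec (a y) 0) as [Ey|Ey]; [now apply Hl|].
    destruct (Nat.eq_dec (a x) 0) as [Ex|Ex].
    { rewrite (Cmod_kern_sym E y x), (dist_sym x y). now apply Hl. }
    destruct (site_label_pos Y lab R2 x Ex) as [x' [Hx1 [Hx2 Hx3]]].
    destruct (site_label_pos Y lab R2 y Ey) as [y' [Hy1 [Hy2 Hy3]]].
    assert (Hs : s < linf_dist x' y').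
    { apply Rnot_le_lt; intros Hle. apply Hxy. unfold a. rewrite Hx3, Hy3.
      now rewrite (L2 x' y' Hx1 Hy1 Hle). }
    assert (Hd1 := dist_triangle x' x y'). assert (Hd2 := dist_triangle x y y').
    rewrite (dist_sym x' x) in Hd1.
    eapply Rle_trans; [apply Hdec|]. rewrite <- exp_plus. apply exp_le_mono.
    (* Here [24 = 140 - 2 * 58]. Half of the rate over this distance gains [12 L]: one [L] for the
       prefactor of [P], eleven for the claim. *)
    assert (24 * (L / c) <= linf_dist x y) by lra. nra.
  - intros x z Ex Exz.
    destruct (site_label_pos Y lab R2 x Ex) as [x' [Hx1 [Hx2 Hx3]]].
    destruct (site_label_pos Y lab R2 z) as [z' [Hz1 [Hz2 Hz3]]].
    { fold a; congruence. }
    assert (Elab : lab x' = lab z').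
    { unfold a in Exz. rewrite Hx3, Hz3 in Exz. now injection Exz. }
    assert (Hd := L3 x' z' Hx1 Hz1 Elab).
    assert (Hcnt : lsum (fun w => ind (lab w = lab x')) Y <= 2 * m).
    { eapply Rle_trans; [|exact HY3]. rewrite <- (Rmult_1_r (INR _)), <- lsum_const.
      apply lsum_le; intros; apply ind_bounds. }
    assert (Hd1 := dist_triangle x x' z). assert (Hd2 := dist_triangle x' z' z).
    rewrite (dist_sym z' z) in Hd2.
    assert (s * lsum (fun w => ind (lab w = lab x')) Y <= s * (2 * m))
      by (apply Rmult_le_compat_l; lra).
    lra.
Qed.

Lemma exp_mult_le a b u v w : 0 <= a -> 0 <= b -> a <= exp u -> b <= exp v -> u + v <= w ->
  a * b <= exp w.
Proof.
  intros Ha Hb Hu Hv H. apply Rle_trans with (exp (u + v)).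
  - rewrite exp_plus. now apply Rmult_le_compat.
  - now apply exp_le_mono.
Qed.

(** The factor 256 is 16 from the threshold [1 / (16 V0)] times 16 from spreading the pivot weights.
    Localization is centred at an arbitrary site of the cluster, so its diameter enters the
    prefactor [exp(54 m L)]. *)
Lemma localized_basis {d} (m : nat) (phi : nat -> vec d) (c L S0 : R) :
  0 < c -> 0 < L -> 1 <= S0 -> exp_summable d (c / 8) S0 -> orthonormal m phi ->
  (forall x y, Cmod (proj_kernel m phi x y) <= exp (L - c * linf_dist x y)) ->
  (1 <= m)%nat -> INR m <= exp L ->
  100 * S0 <= exp L ->
  S0 * exp (- (2 * L)) <= / (4 * (2 * (50 * L / c) + 3) ^ d) ->
  (2 * (58 * L / c) + 3) ^ d <= exp L ->
  exists E : list (vec d), ON E /\ length E = m /\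
    (forall x y, kern E x y = proj_kernel m phi x y) /\
    (forall f, In f E ->
      (exists x, / (256 * (2 * (4 * L / c) + 3) ^ d) <= Cmod (f x) ^ 2) /\
      exists z, forall y, Cmod (f y) <= exp (54 * INR m * L - c / 8 * linf_dist y z)).
Proof.
  intros Hc HL HS1 HS Hphi Hdec Hm1 HmL HSL Hsm HV2.
  assert (HLc : 0 < L / c) by now apply Rdiv_lt_0_compat.
  set (V0 := (2 * (4 * L / c) + 3) ^ d).
  assert (HV0 : 0 < V0) by (apply pow_lt; unfold Rdiv in *; nra).
  set (E0 := map phi (seq 0 m)).
  assert (HE0 : ON E0).
  { apply ON_map; [apply seq_NoDup|]. intros i j Hi Hj.
    apply in_seq in Hi, Hj. apply Hphi; lia. }
  assert (HE0l : length E0 = m) by (unfold E0; now rewrite length_map, length_seq).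
  assert (HE0k : forall x y, kern E0 x y = proj_kernel m phi x y).
  { intros x y. unfold kern, csum, E0. now rewrite map_map. }
  destruct (label_geometry E0 c L S0 Hc HL HS1 HS HE0) as
    [a [N [H [HN [HaN [HHnd [HinH [HHlen [Hoff [Hlight Hdiam]]]]]]]]]]; auto.
  { intros; rewrite HE0k; apply Hdec. }
  rewrite HE0l in *.
  destruct (eigenbasis m phi a H Hphi HHnd (fun x => proj2 (HinH x)))
    as [E [HON [HEl [HEk Heig]]]].
  assert (HEk0 : forall x y, kern E0 x y = kern E x y) by (intros; now rewrite HE0k, HEk).
  assert (Hmpos := pos_INR m). assert (HNpos := pos_INR N).
  assert (Hm1' : 1 <= INR m) by (apply (le_INR 1); exact Hm1).
  assert (He1 : 100 <= exp L) by lra.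
  set (K := fun k => selectP (fun x => a x = k) H).
  assert (HKnd : forall k, NoDup (K k)) by (intros; now apply NoDup_selectP).
  assert (HK : forall k x, (1 <= k)%nat -> In x (K k) <-> a x = k).
  { intros k x Hk. unfold K. rewrite in_selectP, HinH. split; [tauto|].
    intros E1; split; auto; lia. }
  (* The support has at most [2 m] balls: one power of [exp L] each for the 2, for [m] and for the
     volume. *)
  set (kappa := exp (3 * L)).
  assert (He3 : exp (3 * L) = exp L * exp L * exp L).
  { rewrite <- !exp_plus; f_equal; ring. }
  assert (Hkappa : forall k, INR (length (K k)) <= kappa).
  { intros k. apply Rle_trans with (INR (length H)).
    - apply le_INR. unfold K, selectP. apply filter_length_le.
    - eapply Rle_trans; [exact HHlen|]. unfold kappa. rewrite He3.
      apply Rmult_le_compat; try lra.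
      + apply pow_le. unfold Rdiv in *; nra.
      + nra. }
  set (beta := exp (- (11 * L))).
  assert (Hbeta : 0 < beta) by apply exp_pos.
  assert (Hbe : beta * exp L * exp L = exp (- (9 * L))).
  { unfold beta; rewrite <- !exp_plus; f_equal; ring. }
  assert (Hexpneg : forall t, 1 <= t -> exp (- (t * L)) <= 1 / 100).
  { intros t Ht. apply Rle_trans with (exp (- L)); [apply exp_le_mono; nra|].
    rewrite exp_Ropp. apply Rle_trans with (/ 100); [|lra].
    apply Rinv_le_contravar; lra. }
  (* The off-label constant of [eigen_localized]; two of the eleven powers in [beta] pay for
     [4 N S0], leaving nine. *)
  set (eps := 4 * INR N * beta * S0).
  assert (Heps0 : 0 <= eps) by (unfold eps; repeat apply Rmult_le_pos; lra).
  assert (Heps : eps <= exp (- (9 * L))).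
  { unfold eps. rewrite <- Hbe. assert (4 * INR N * S0 <= exp L * exp L) by nra. nra. }
  assert (Hsmall : 8 * (INR N + 1) * beta * S0 < 1).
  { assert (8 * (INR N + 1) * S0 <= exp L * exp L) by nra.
    assert (H9 := Hexpneg 9 ltac:(lra)). rewrite <- Hbe in H9. nra. }
  assert (Hloc : forall f, exists l, In f E -> (1 <= l)%nat /\ (l <= N)%nat /\ (exists x, a x = l) /\
    (forall y, Cmod (f y) <= 2 * Phi c (K l) y) /\
    (forall y, a y <> l -> Cmod (f y) <= eps * Phi c (K l) y)).
  (* Choice requires a label for every function; those outside [E] get the dummy value 0. *)
  { intros f. destruct (classic (In f E)) as [Hf|Hf]; [|exists 0%nat; tauto].
    destruct (Heig f Hf) as [lam Hlam].
    destruct (eigen_localized E c S0 beta (exp L) N a K H f lam) as [l Hl]; auto.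
    - lra.
    - intros x; apply HinH.
    - intros x y Hxy. rewrite <- HEk0. now apply Hoff.
    - intros x y Hy. rewrite <- HEk0. now apply Hlight.
    - intros x y. rewrite HEk. eapply Rle_trans; [apply Hdec|].
      rewrite <- exp_plus. apply exp_le_mono. assert (Hd := dist_nonneg x y). nra.
    - exists l; intros _; exact Hl. }
  destruct (ClassicalEpsilon.choice _ Hloc) as [lf Hlf].
  assert (Hpart := partition_by_label lf (seq 1 N) (seq_NoDup N 1) E).
  set (Es := map (fun l => selectP (fun f => lf f = l) E) (seq 1 N)) in *.
  specialize (Hpart ltac:(intros f Hf; apply in_seq; destruct (Hlf f Hf) as [? [? _]]; lia)).
  set (eta0 := 1 / (16 * V0)).
  assert (Heta0 : 0 < eta0) by (apply Rdiv_lt_0_compat; lra).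
  assert (Hek : eps * kappa <= exp (- (6 * L))).
  { apply exp_mult_le with (- (9 * L)) (3 * L); auto; try lra; unfold kappa; [|lra].
    left; apply exp_pos. }
  assert (Hek2 : (eps * kappa) ^ 2 <= exp (- (12 * L))).
  { replace (- (12 * L)) with (2 * - (6 * L)) by ring. rewrite <- exp_sq.
    apply pow_incr; split; auto. apply Rmult_le_pos; auto. left; apply exp_pos. }
  destruct (rotate_classes eta0 Heta0 Es nil) as [E' [G1 [G2 [G3 G4]]]].
  - rewrite app_nil_r. now apply (ON_perm E).
  - intros F HF. apply in_map_iff in HF; destruct HF as [l [<- Hl]].
    apply in_seq in Hl. cbv beta.
    destruct (Nat.eq_dec (length (selectP (fun f => lf f = l) E)) 0) as [E1|E1].
    + exists nil. split; [constructor|]. split; [simpl; tauto|].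
      replace (length _) with 0%nat by (symmetry; exact E1). unfold lsum; simpl; lra.
    (* The radius [4 L / c] is of order [L], so [V0] is of order [L^d], yet the far part of the
       kernel is already at most [S0 exp(- 5/2 L)]. *)
    + eexists. split; [|split; [|
        apply (class_concentrated E lf a K c L S0 eps kappa (4 * L / c) V0 eta0 l)]];
        auto; try lia.
      * apply NoDup_selectP, HKnd.
      * intros x Hx. now apply in_selectP in Hx.
      * unfold Rdiv in *; nra.
      * intros; rewrite HEk; apply Hdec.
      * intros f Hf. now apply Hlf.
      * intros f y Hf. now apply (Hlf f Hf).
      * apply Rle_refl.
      * rewrite HEl.
        replace (INR m * eps ^ 2 * kappa ^ 2 * S0) with ((INR m * S0) * (eps * kappa) ^ 2) by ring.
        apply Rle_trans with (exp (- (10 * L))); [|specialize (Hexpneg 10); lra].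
        apply exp_mult_le with (2 * L) (- (12 * L)); auto using pow2_ge_0; try lra.
        -- apply Rmult_le_pos; lra.
        -- apply exp_mult_le with L L; lra.
      * rewrite HEl.
        replace (L - 7 * c / 8 * (4 * L / c)) with (- (5 / 2 * L)) by (field; lra).
        assert (H1 : S0 * exp (- (5 / 2 * L)) <= exp (- (3 / 2 * L))).
        { apply exp_mult_le with L (- (5 / 2 * L)); try lra. left; apply exp_pos. }
        assert (H2 := Hexpneg (3 / 2) ltac:(lra)).
        assert (H3 : kappa * (INR m * (eps * kappa) ^ 2) <= exp (- (8 * L))).
        { apply exp_mult_le with (3 * L) (- (11 * L)); try lra.
          - left; apply exp_pos.
          - apply Rmult_le_pos; auto using pow2_ge_0.
          - unfold kappa; lra.
          - apply exp_mult_le with L (- (12 * L)); auto using pow2_ge_0; lra. }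
        assert (H4 := Hexpneg 8 ltac:(lra)). lra.
  - rewrite app_nil_r in G1. exists E'. split; [exact G1|]. split; [|split].
    + etransitivity; [exact G2|]. rewrite <- HEl. symmetry. now apply Permutation_length.
    + intros x y. rewrite G3, <- HEk. symmetry. now apply kern_perm.
    + intros f Hf. destruct (G4 f Hf) as [[x Hx] [F [HF HFd]]]. split.
      * exists x. eapply Rle_trans; [|exact Hx]. apply Req_le. unfold eta0, V0. field.
        fold V0; lra.
      * apply in_map_iff in HF; destruct HF as [l [<- Hl]]. apply in_seq in Hl. cbv beta in HFd.
        destruct (classic (exists z, a z = l)) as [[z Hz]|Hno].
        (* A label borne by no site has an empty class; the domination by its diagonal forces
           [f = 0], and any centre will do. *)
        2:{ assert (Hnil : selectP (fun f => lf f = l) E = nil).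
            { destruct (selectP (fun f => lf f = l) E) as [|g S'] eqn:ES; auto.
              assert (Hg : In g (selectP (fun f => lf f = l) E)) by (rewrite ES; now left).
              apply in_selectP in Hg; destruct Hg as [Hg Hgl].
              exfalso; apply Hno. rewrite <- Hgl. now apply (Hlf g Hg). }
            exists x. intros y. specialize (HFd y). rewrite Hnil in HFd.
            unfold diag, lsum in HFd; simpl in HFd.
            assert (Hf0 := Cmod_ge_0 (f y)). assert (Cmod (f y) = 0) as -> by nra.
            left; apply exp_pos. }
        exists z; intros y.
        set (rho := 2 * (58 * L / c) + 140 * L / c * (2 * INR m)) in *.
        assert (HPhi : Phi c (K l) y <= exp (3 * L + (c / 8 * rho - c / 8 * linf_dist y z))).
        { unfold Phi. apply Rle_trans with
            (lsum (fun _ => exp (c / 8 * rho - c / 8 * linf_dist y z)) (K l)).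
          - apply lsum_le; intros w Hw. apply exp_le_mono.
            apply HK in Hw; [|lia].
            assert (H1 := Hdiam w z ltac:(lia) ltac:(congruence)).
            assert (H2 := dist_triangle y w z). nra.
          - rewrite lsum_const.
            apply exp_mult_le with (3 * L) (c / 8 * rho - c / 8 * linf_dist y z);
              auto using pos_INR; try lra; try apply Rle_refl.
            left; apply exp_pos. }
        assert (Hrho : c / 8 * rho <= 99 / 2 * INR m * L).
        { unfold rho. replace (c / 8 * _) with (29 / 2 * L + 35 * INR m * L) by (field; lra). nra. }
        (* The constant is [54 = 99/2 + 4 + 1/2]: cluster diameter, then cluster size with the
           factor 2, then the square root of the number of vectors in the class. *)
        set (u := 4 * L + (c / 8 * rho - c / 8 * linf_dist y z)).
        assert (H2Phi : 2 * Phi c (K l) y <= exp u).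
        { apply exp_mult_le with L (3 * L + (c / 8 * rho - c / 8 * linf_dist y z)); try lra.
          - apply Phi_nonneg.
          - unfold u; lra. }
        apply le_of_sq; [left; apply exp_pos|].
        eapply Rle_trans; [apply HFd|].
        apply Rle_trans with (INR m * exp u ^ 2).
        -- unfold diag.
           apply Rle_trans with (lsum (fun _ : vec d => exp u ^ 2) (selectP (fun f => lf f = l) E)).
           ++ apply lsum_le; intros g Hg. apply in_selectP in Hg; destruct Hg as [Hg Hgl].
              apply pow_incr; split; [apply Cmod_ge_0|].
              eapply Rle_trans; [|exact H2Phi]. rewrite <- Hgl. now apply (Hlf g Hg).
           ++ rewrite lsum_const. apply Rmult_le_compat_r; [apply pow2_ge_0|].
              rewrite <- HEl. apply le_INR. unfold selectP. apply filter_length_le.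
        -- rewrite !exp_sq. apply exp_mult_le with L (2 * u); try lra.
           ++ left; apply exp_pos.
           ++ unfold u. nra.
Qed.

(** * Choice of constants *)

(** With [n = d + 1], [exp L = exp(L / n)^n >= (L / n)^n]; the one power of [L] beyond [L^d] absorbs
    [A] and [n^n]. *)
Lemma exp_dominates_pow (d : nat) (A L : R) :
  0 < L -> A * INR (S d) ^ S d <= L -> A * L ^ d <= exp L.
Proof.
  intros HL HA. set (n := INR (S d)) in *.
  assert (Hn : 0 < n) by (apply lt_0_INR; lia).
  assert (Hpow : forall k, exp (INR k * (L / n)) = exp (L / n) ^ k).
  { induction k as [|k IH]; [simpl; rewrite Rmult_0_l; apply exp_0|].
    rewrite S_INR, Rmult_plus_distr_r, exp_plus, IH, Rmult_1_l. simpl; ring. }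
  assert (HE : exp L = exp (L / n) ^ S d).
  { rewrite <- Hpow. f_equal. fold n. field; lra. }
  assert (Hx : 0 < L / n) by now apply Rdiv_lt_0_compat.
  rewrite HE. apply Rle_trans with ((L / n) ^ S d).
  - assert (Hnp : 0 < n ^ S d) by now apply pow_lt.
    unfold Rdiv; rewrite Rpow_mult_distr, pow_inv. fold (Rdiv (L ^ S d) (n ^ S d)).
    apply (proj1 (Rle_div_r _ _ _ Hnp)). simpl (L ^ S d).
    assert (HLd : 0 < L ^ d) by now apply pow_lt.
    replace (A * L ^ d * n ^ S d) with (A * n ^ S d * L ^ d) by ring.
    apply Rmult_le_compat_r; lra.
  - apply pow_incr. split; [lra|]. assert (H := exp_ineq1_le (L / n)). lra.
Qed.

Lemma affine_pow_le (d : nat) (a L : R) :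
  0 <= a -> 1 <= L -> (a * L + 3) ^ d <= (a + 3) ^ d * L ^ d.
Proof.
  intros Ha HL. rewrite <- Rpow_mult_distr. apply pow_incr; nra.
Qed.

Theorem theoremB2 :
  forall (d : nat) (c : R), 0 < c ->
  exists c' : R, 0 < c' /\
  exists theta0 : R, 0 < theta0 /\
  forall (m : nat) (theta : R), 0 < theta -> INR m ^ 3 * theta < theta0 ->
  forall P : Zd d -> Zd d -> C,
    is_rank_proj m P ->
    (forall x y : Zd d, Cmod (P x y) * exp (c * linf_dist x y) <= / theta) ->
    exists psi : nat -> vec d,
      orthonormal m psi /\
      (forall x y, P x y = proj_kernel m psi x y) /\
      (forall i, (i < m)%nat ->
         M_ge (psi i) (/ (Rabs (ln theta)) ^ (d + 1)) /\
         exists xi : Zd d, forall y : Zd d,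
           Cmod (psi i y) <= / theta ^ 2 * exp (- (c' * linf_dist y xi / INR m))).
Proof.
  intros d c Hc.
  destruct (exp_sum_bound d (c / 8) ltac:(lra)) as [S0 [HS1 HS]].
  (* [B] lets [exp L] dominate ball volumes up to the largest radius [58 L / c]. [G] is the constant
     in the peak bound, paid for by the extra factor [L] in [L^(d+1)]. *)
  set (B := (116 / c + 3) ^ d * INR (S d) ^ S d).
  set (G := 256 * (8 / c + 3) ^ d).
  assert (Hcpos : forall k, 0 < k -> 0 < k / c) by (intros; now apply Rdiv_lt_0_compat).
  assert (H116 := Hcpos 116 ltac:(lra)). assert (H8 := Hcpos 8 ltac:(lra)).
  assert (HB : 0 <= B).
  { apply Rmult_le_pos; apply pow_le; [lra|apply pos_INR]. }
  assert (HG : 0 <= G).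
  { apply Rmult_le_pos; [lra|]. apply pow_le; lra. }
  set (L0 := 1 + 100 * S0 + B + G).
  (* [216 = 8 * 27]: dividing the exponent [54 m L - c/8 |y - x|] by [27 m] leaves exactly [2 L],
     that is the prefactor [theta^-2]. *)
  exists (c / 216). split; [lra|].
  exists (exp (- L0)). split; [apply exp_pos|].
  intros m theta Hth Hm P [phi [Hphi HP]] Hdec.
  destruct (Nat.eq_dec m 0) as [->|Hm0].
  (* Rank zero is vacuous and is set aside, because exponents are divided by [INR m] below. *)
  { exists phi. split; [exact Hphi|split; [exact HP|intros i Hi; lia]]. }
  assert (Hm1 : 1 <= INR m) by (apply (le_INR 1); lia).
  assert (Hm3 : INR m <= INR m ^ 3).
  { assert (1 <= INR m * INR m) by nra. simpl; nra. }
  set (L := - ln theta).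
  assert (HeL : exp L = / theta) by (unfold L; rewrite exp_Ropp, exp_ln; auto).
  (* As [m >= 1], the smallness assumption yields [theta < exp(- L0)], hence [L > L0], and also
     [m <= exp L]. *)
  assert (Hinv : theta * / theta = 1) by (field; lra).
  assert (HL0 : L0 < L).
  { apply exp_lt_inv. rewrite HeL.
    assert (He : exp (- L0) * exp L0 = 1) by (rewrite <- exp_plus, <- exp_0; f_equal; ring).
    assert (HeL0 := exp_pos L0).
    assert (theta < exp (- L0)) by nra.
    assert (exp L0 * theta < 1) by nra.
    apply Rmult_lt_reg_r with theta; lra. }
  assert (HL1 : 1 <= L) by (unfold L0 in HL0; lra).
  assert (HmL : INR m <= exp L).
  { rewrite HeL. apply Rmult_le_reg_r with theta; auto.
    assert (exp (- L0) < 1) by (rewrite <- exp_0; apply exp_increasing; unfold L0; lra).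
    rewrite (Rmult_comm (/ theta)), Hinv. nra. }
  assert (HexpL : L <= exp L) by (assert (H := exp_ineq1_le L); lra).
  assert (Haff : forall k, 0 <= k -> 2 * (k * L / c) + 3 = 2 * k / c * L + 3)
    by (intros; field; lra).
  assert (HV : forall k, 0 <= k <= 58 -> (2 * (k * L / c) + 3) ^ d <= exp L).
  { intros k Hk. apply Rle_trans with ((116 / c * L + 3) ^ d).
    - apply pow_incr. rewrite Haff by lra.
      assert (0 <= 2 * k / c) by (apply Rdiv_le_0_compat; lra).
      assert (2 * k / c <= 116 / c).
      { unfold Rdiv. apply Rmult_le_compat_r; [left; now apply Rinv_0_lt_compat|lra]. }
      split; nra.
    - eapply Rle_trans; [apply affine_pow_le; lra|].
      apply exp_dominates_pow; [lra|]. fold B. unfold L0 in HL0; lra. }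
  assert (Hphidec : forall x y, Cmod (proj_kernel m phi x y) <= exp (L - c * linf_dist x y)).
  { intros x y. rewrite <- HP. specialize (Hdec x y). rewrite <- HeL in Hdec.
    unfold Rminus; rewrite exp_plus, exp_Ropp.
    apply Rle_div_r; [apply exp_pos|exact Hdec]. }
  destruct (localized_basis m phi c L S0) as [E [HON [HEl [HEk HE]]]]; auto; try lra; try lia.
  - unfold L0 in HL0; lra.
  - assert (HV1 := HV 50 ltac:(lra)).
    assert (HV1pos : 0 < (2 * (50 * L / c) + 3) ^ d).
    { apply pow_lt. assert (0 < 50 * L / c) by (apply Rdiv_lt_0_compat; lra). lra. }
    set (V1 := (2 * (50 * L / c) + 3) ^ d) in *.
    assert (H100 : 4 * S0 <= exp L) by (unfold L0 in HL0; lra).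
    replace (- (2 * L)) with (- (L + L)) by ring. rewrite exp_Ropp, exp_plus.
    assert (HeLpos := exp_pos L).
    apply Rle_div_l; [nra|]. rewrite Rmult_comm.
    apply (Rle_div_r S0 (exp L * exp L) (4 * V1)) ; [lra|]. nra.
  - apply HV; lra.
  - assert (Hnth : forall i, (i < m)%nat -> In (nth i E (fun _ => RtoC 0)) E).
    { intros i Hi; apply nth_In. now rewrite HEl. }
    exists (fun i => nth i E (fun _ => RtoC 0)). split; [|split].
    + intros i j Hi Hj. apply (ON_nth E (fun _ => RtoC 0) HON); change (Zd d -> C) with (vec d); now rewrite HEl.
    + intros x y. rewrite HP, <- HEk. unfold proj_kernel, kern, csum.
      rewrite <- HEl, <- (map_nth_all E (fun _ => RtoC 0)) at 1. now rewrite map_map.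
    + intros i Hi. set (f := nth i E (fun _ => RtoC 0)).
      assert (Hf : In f E) by now apply Hnth.
      destruct (HE f Hf) as [[x Hx] [z Hz]]. split.
      * exists x. eapply Rle_trans; [|exact Hx].
        assert (HabsL : Rabs (ln theta) = L).
        { unfold L. apply Rabs_left1. unfold L in HL1; lra. }
        rewrite HabsL.
        assert (Hpos : 0 < (2 * (4 * L / c) + 3) ^ d).
        { apply pow_lt. assert (0 < 4 * L / c) by (apply Rdiv_lt_0_compat; lra). lra. }
        apply Rinv_le_contravar; [lra|].
        rewrite Haff by lra. replace (2 * 4 / c) with (8 / c) by (field; lra).
        assert (H1 := affine_pow_le d (8 / c) L ltac:(lra) HL1).
        rewrite pow_add, pow_1.
        assert (HLd : 0 < L ^ d) by (apply pow_lt; lra).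
        assert (G <= L) by (unfold L0 in HL0; lra). unfold G in *. nra.
      * exists z; intros y. specialize (Hz y).
        assert (Hf1 : Cmod (f y) <= 1) by (apply unit_pointwise_le, (ON_in E); auto).
        replace (/ theta ^ 2) with (exp (2 * L)).
        2:{ rewrite <- exp_sq, HeL. field; lra. }
        rewrite <- exp_plus.
        (* Both bounds on [f] combine to the power [1/(27 m)] of the second one. *)
        set (X := 54 * INR m * L - c / 8 * linf_dist y z) in *.
        replace (2 * L + - (c / 216 * linf_dist y z / INR m)) with (X / (27 * INR m))
          by (unfold X; field; lra).
        destruct (Rle_dec 0 X) as [HX|HX].
        -- apply Rle_trans with 1; auto. rewrite <- exp_0 at 1. apply exp_le_mono.
           apply Rdiv_le_0_compat; lra.
        -- eapply Rle_trans; [exact Hz|]. apply exp_le_mono.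
           apply Rle_div_r; nra.
Qed.
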